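(* Assume the setting described in the context (random geometric graph $G=G(r_n)$ with location density $f$ satisfying $\epsilon_1\le f\le\epsilon_2$ on $S$, i.i.d. edge weights with inverse ccdf $H$). Suppose there are constants $0<\beta<c<\frac12$ (strict inequalities) such that $$r_n\ge \frac{1}{n^{\beta}},\qquad q_n=\frac{1}{n^{c}},\qquad L_n:=\frac{\zeta_n}{r_n}\ge 1 .$$ Suppose also that $H(z)$ is strictly increasing for all large $z$. Then for every $\gamma,\kappa>0$ and for all sufficiently small $0<\varepsilon<1$ (i.e. there is $\varepsilon_0\in(0,1)$ such that for every $\varepsilon\in(0,\varepsilon_0)$), there are constants $\theta_1,\theta_2>0$, not depending on $n$, such that for all $n$ large $$\mathbb{P}\bigl(M_n(\theta_1L_n,q_n,w_n)\ge \theta_2L_n\alpha_n\bigr)\ge 1-\frac{1}{n^{1+\gamma}},$$ where $N:=nr_n^2$, $w_n:=H(N^{1-\varepsilon})$ and $$\alpha_n:=\begin{cases}H\!\left(\dfrac{N^2}{(\log n)^{1+\kappa}}\right), & L_n\le(\log n)^{1+\kappa},\\[2mm] H(N^2), & \text{otherwise.}\end{cases}$$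
   Context: Setting. Let $S=[-\frac12,\frac12]^2$ and let $f$ be a probability density on $S$ (not depending on $n$) with $\epsilon_1\le f(x)\le\epsilon_2$ for all $x\in S$, for some positive finite constants $\epsilon_1,\epsilon_2$. For each $n$, let $X_1,\dots,X_n$ be i.i.d. with density $f$; $X_v$ is the location of vertex $v\in\{1,\dots,n\}$. Add two deterministic vertices $O_1,O_2$ with locations $X_{O_1}=(0,0)$ and $X_{O_2}=(\zeta_n,0)$, where $0<\zeta_n<\frac12$ is a deterministic sequence. Let $K_n^{(2)}$ be the graph on $\{1,\dots,n\}\cup\{O_1,O_2\}$ whose edges are all pairs of distinct vertices of $\{1,\dots,n\}$ together with all pairs $(O_1,j),(O_2,j)$, $1\le j\le n$. For a deterministic sequence $0<r_n<1$, the random geometric graph $G=G(r_n)$ is the subgraph of $K_n^{(2)}$ formed by all edges $(u,v)$ with $d(X_u,X_v)<r_n$, where $d$ is Euclidean distance. Weights. The edges $h$ of $K_n^{(2)}$ carry i.i.d. weights $W(h)$, independent of the locations, with $0<W(h)<\infty$ a.s. and common law not depending on $n$. The ccdf is $F_c(x):=\mathbb{P}(W(h)>x)$, $x>0$, and the inverse ccdf is $H(z):=\sup\{x>0: F_c(x)\ge \frac1z\}$ for $z>1$, so $0<H(z)<\infty$. Paths. A path from $O_1$ to $O_2$ in $G$ is a sequence of distinct vertices $\Pi=(v_0=O_1,v_1,\dots,v_t=O_2)$ such that each $(v_i,v_{i+1})$, $0\le i\le t-1$, is an edge of $G$. For $l,q,w\ge0$, $\Pi$ is an $(l,q,w)$-path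 if it has at most $l$ edges ($t\le l$), $d(X_{v_i},X_{v_{i+1}})\ge q$ for all $0\le i\le t-1$, and $W(v_i,v_{i+1})\ge w$ for all $0\le i\le t-1$. Its weight is $W(\Pi)=\sum_{i=0}^{t-1}W(v_i,v_{i+1})$. $M_n(l,q,w)$ is the maximum weight of an $(l,q,w)$-path in $G$, with the maximum of the empty set equal to $0$. *)

(* Defs.v *)
From HB Require Import structures.
From mathcomp Require Import all_boot all_order all_algebra.
From mathcomp Require Import all_classical all_reals all_analysis.

Set Implicit Arguments.
Unset Strict Implicit.
Unset Printing Implicit Defensive.

Import Order.TTheory GRing.Theory Num.Theory.
Import numFieldNormedType.Exports.

Local Open Scope classical_set_scope.
Local Open Scope ring_scope.

Section Independence.
Context {d : measure_display} {T : measurableType d} {R : realType}.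
Variable P : probability T R.

Definition mutually_independent (I : finType) (D : {set I})
    (F : I -> set (set T)) : Prop :=
  forall (J : {set I}) (A : I -> set T), J \subset D ->
    (forall i, i \in J -> F i (A i)) ->
    P (\bigcap_(i in [set i | i \in J]) A i) = (\prod_(i in J) P (A i))%E.

Definition independent_classes (F G : set (set T)) : Prop :=
  forall A B, F A -> G B -> P (A `&` B) = (P A * P B)%E.

Definition sigma_of_family {d' : measure_display} {T' : measurableType d'}
    (I : finType) (D : {set I}) (Y : I -> T -> T') : set (set T) :=
  <<s \bigcup_(i in [set i | i \in D]) g_sigma_algebra_preimage (Y i) >>.

End Independence.

Section Graph.
Variable n : nat.

(* inl i is the i-th random vertex; the two added vertices are inr _. *)
Definition vertex : finType := ('I_n + bool)%type.
Definition O1 : vertex := inr false.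
Definition O2 : vertex := inr true.

(* Edges are unordered pairs; O1O2 is the only pair that is not an edge. *)
Definition K2_edges : {set {set vertex}} :=
  [set e : {set vertex} | (#|e| == 2)%N && (e != [set O1; O2])%SET]%SET.

End Graph.
Arguments O1 {n}.
Arguments O2 {n}.

Section Paths.
Context {R : realType}.

Definition unit_square : set (R * R) :=
  `[- 2^-1, 2^-1]%classic `*` `[- 2^-1, 2^-1]%classic.

Definition euclid_dist (x y : R * R) : R :=
  Num.sqrt ((x.1 - y.1) ^+ 2 + (x.2 - y.2) ^+ 2).

Variable n : nat.

Definition location (zeta : R) (X : 'I_n -> R * R) (v : vertex n) : R * R :=
  match v with
  | inl i => X i
  | inr false => (0, 0)
  | inr true => (zeta, 0)
  end.

Variables (r : R) (loc : vertex n -> R * R) (wt : {set vertex n} -> R).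

Definition rgg_adj : rel (vertex n) := fun u v =>
  ([set u; v]%SET \in K2_edges n) && (euclid_dist (loc u) (loc v) < r).

(* A path (O1, v_1, ..., v_t = O2) is represented by p = [:: v_1; ...; v_t],
   so that t = size p. *)
Definition rgg_path (p : seq (vertex n)) : bool :=
  [&& uniq (O1 :: p), last O1 p == O2 & path rgg_adj O1 p].

Definition lqw_path (l q w : R) (p : seq (vertex n)) : bool :=
  [&& rgg_path p, (size p)%:R <= l &
      path (fun u v => (q <= euclid_dist (loc u) (loc v)) &&
                       (w <= wt [set u; v]%SET)) O1 p].

Definition path_weight (p : seq (vertex n)) : R :=
  \sum_(e <- zip (O1 :: p) p) wt [set e.1; e.2]%SET.

(* There are finitely many paths, so that this supremum is a maximum (see
   max_weightP); it is 0 when there is no (l,q,w)-path (see max_weight0). *)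
Definition max_weight (l q w : R) : R :=
  sup [set path_weight p | p in [set p | lqw_path l q w p]].

Lemma max_weightP (l q w : R) : (exists p, lqw_path l q w p) ->
  exists2 p, lqw_path l q w p & max_weight l q w = path_weight p /\
    (forall p', lqw_path l q w p' -> path_weight p' <= path_weight p).
Proof.
move=> [p0 Hp0].
have sz p : lqw_path l q w p -> (size p <= #|vertex n|)%N.
  move=> /and3P[/and3P[+ _ _] _ _] => /card_uniqP Ep.
  by apply: (leq_trans (leqnSn _)); rewrite -[(size p).+1]Ep max_card.
pose b0 : (#|vertex n|).-bseq (vertex n) := Bseq (sz p0 Hp0).
case: (@arg_maxP _ _ _ b0 (fun b => lqw_path l q w (val b))
  (fun b => path_weight (val b)) Hp0) => b Hb bmax.
have pmax p' : lqw_path l q w p' -> path_weight p' <= path_weight (val b).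
  by move=> Hp'; exact: (bmax (Bseq (sz p' Hp'))).
exists (val b) => //; split=> //; apply/le_anti/andP; split.
- apply: ge_sup; first by exists (path_weight p0), p0.
  by move=> _ [p' Hp' <-]; exact: pmax.
- apply: ub_le_sup; last by exists (val b).
  by exists (path_weight (val b)) => _ [p' Hp' <-]; exact: pmax.
Qed.

Lemma max_weight0 (l q w : R) : (forall p, ~~ lqw_path l q w p) ->
  max_weight l q w = 0.
Proof.
move=> H; rewrite /max_weight (_ : [set p | _] = set0) ?image_set0 ?sup0 //.
by apply/seteqP; split=> // p /= Hp; move: (H p); rewrite Hp.
Qed.

End Paths.

Section Scales.
Context {R : realType}.

(* nu is the common law of the weights, so nu ]x, +oo[ = P(W > x). *)
Definition ccdf_of (nu : probability R R) (x : R) : \bar R :=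
  nu `]x, +oo[%classic.

Definition inv_ccdf (nu : probability R R) (z : R) : R :=
  sup [set x : R | 0 < x /\ ((z^-1)%:E <= ccdf_of nu x)%E].

Definition alpha_scale (H : R -> R) (kappa : R) (n : nat) (N L : R) : R :=
  let logk := (ln n%:R) `^ (1 + kappa) in
  if L <= logk then H (N ^+ 2 / logk) else H (N ^+ 2).

End Scales.

(* Main.v *)
(** Cut the segment from [O1] to [O2] into [l] consecutive cells of side about [r], with gaps,
so that any two points of neighbouring cells are at distance in [[q, r)].  With overwhelming
probability every cell contains at least [M], of order [N = n r^2], vertices (Chernoff).  The
path takes one vertex in each cell, which makes it self-avoiding.

Conditionally on the cells of the vertices, two kinds of events matter, and both are treated by
union bounds over sets of vertices from [P (no open edge in Q) <= exp (- p |Q|)]: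
- sets of [g^i] vertices of a cell have [g^(i+1)] neighbours of weight at least [w] in the next
  and in the previous cell, where [g] is a small power of [N], and two sets of [g^K] vertices of
  consecutive cells are joined.  Growing such neighbourhoods from both ends links any
  two prescribed vertices that are [2K + 1] cells apart; since this is uniform in the two
  vertices, they may be chosen depending on the weights;
- among the pairs of cells between consecutive links, all (small [L]) or a positive fraction
  (large [L]) contain an edge of weight at least [alpha], because such a pair has [M^2], of order
  [N^2], edges.
Taking these edges as the prescribed ones and linking them gives the path. *)

Require Import Defs.
From HB Require Import structures.
From mathcomp Require Import all_boot all_order all_algebra.
From mathcomp Require Import all_classical all_reals all_analysis.
From mathcomp Require Import zify ring lra.

Set Implicit Arguments.
Unset Strict Implicit.
Unset Printing Implicit Defensive.

Import Order.TTheory GRing.Theory Num.Theory.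
Import numFieldNormedType.Exports.

Local Open Scope classical_set_scope.
Local Open Scope ring_scope.

(** * Probability estimates *)

(** The length of a link is dictated by [p = N^(-(1-eps))], a lower bound for the probability that
    an edge has weight at least [w]. The union bound over pairs of sets of [s] vertices works once
    [p s^2] beats the entropy [s log n] of choosing them; with [s] about [N^(1-eps/2)] one has
    [p s = N^(eps/2)], which is enough. One step enlarges every set by the factor [g] once [p M], of
    order [N^eps], beats [g log n], so [g] may be of order [N^(eps/2)]. Reaching [N^(1-eps/2)] at
    this pace takes [K >= 2/eps] steps. All this needs powers of [N] to dominate [log n], which
    [beta < 1/2] provides. The two cases of [alpha] come from the same count. At level [H(N^2)] the
    failure probability of a stage is only bounded by a constant below 1, and a positive fraction of
    heavy stages is guaranteed up to an error exponential in [L]; this is negligible when [L]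
    exceeds [(log n)^(1+kappa)]. For smaller [L] every stage has to succeed, and dividing [N^2] by
    this power of the logarithm makes each failure superpolynomially small. *)

Section ProbabilityTools.
Context {d : measure_display} {T : measurableType d} {R : realType}.
Variable P : probability T R.

Definition pr (E : set T) : R := fine (P E).

Lemma prE (E : set T) : measurable E -> P E = (pr E)%:E.
Proof. by move=> mE; rewrite /pr fineK// fin_num_measure. Qed.

Lemma pr_ge0 (E : set T) : 0 <= pr E.
Proof. by rewrite fine_ge0. Qed.

Lemma le_pr (A B : set T) : measurable A -> measurable B -> A `<=` B ->
  pr A <= pr B.
Proof.
by move=> mA mB AB; rewrite -lee_fin -!prE// le_measure// inE.
Qed.

Lemma pr_setC (A : set T) : measurable A -> pr (~` A) = 1 - pr A.
Proof.
move=> mA; apply: EFin_inj.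
by rewrite -prE ?probability_setC ?prE//; exact: measurableC.
Qed.

Lemma pr_setT : pr setT = 1.
Proof. by rewrite /pr probability_setT. Qed.

Lemma pr_setU_le (A B : set T) : measurable A -> measurable B ->
  pr (A `|` B) <= pr A + pr B.
Proof.
move=> mA mB; rewrite -lee_fin EFinD -!prE//; last exact: measurableU.
exact: measureU2.
Qed.

Lemma union_bound (I : finType) (Q : pred I) (F : I -> set T) (E : set T) :
  measurable E -> (forall i, Q i -> measurable (F i)) ->
  (forall t, E t -> exists2 i, Q i & F i t) ->
  pr E <= \sum_(i | Q i) pr (F i).
Proof.
move=> mE mF EF.
have mU s : measurable (\big[setU/set0]_(i <- s | Q i) F i).
  exact: bigsetU_measurable.
apply: (@le_trans _ _ (pr (\big[setU/set0]_(i <- index_enum I | Q i) F i))).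
  apply: le_pr => // t /EF[i Qi Fit]; rewrite -bigcup_seq_cond.
  by exists i => //=; rewrite mem_index_enum.
elim: (index_enum I) => [|i s IH]; first by rewrite !big_nil /pr measure0.
rewrite !big_cons; case: ifP => // Qi.
by rewrite (le_trans (pr_setU_le _ _))// ?lerD2l//; exact: mF.
Qed.

End ProbabilityTools.

(** Most events below depend on a finite pattern (which vertices lie in which cells, which edges are
    heavy), hence are finite unions of atoms, whatever the predicate [Q]. The lemma also serves for
    the sigma-algebras generated by the locations and by the weights. *)
Lemma measurable_pattern d (T : measurableType d) (I : finType)
    (Y : I -> T -> bool) (Q : set {set I}) :
  (forall i, measurable [set t | Y i t]) ->
  measurable [set t | Q [set i | Y i t]%SET].
Proof.
move=> mY.
have -> : [set t | Q [set i | Y i t]%SET] =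
  \bigcup_(S in Q) \bigcap_i (if i \in S then [set t | Y i t]
                              else ~` [set t | Y i t]).
  apply/seteqP; split=> t /=.
    by move=> QY; exists [set i | Y i t]%SET => // i _; rewrite inE;
       case: ifPn => //= /negP.
  move=> [S QS SY]; rewrite (_ : [set i | Y i t]%SET = S)//.
  apply/setP => i; rewrite inE; have := SY i Logic.I.
  by case: ifPn => //= _ /negP/negbTE.
apply: fin_bigcup_measurable => // S _; apply: fin_bigcap_measurable => // i _.
by case: ifP => // _; exact: measurableC.
Qed.

(** * Lower tails for the number of events that occur in a finite family *)

Section Concentration.
Context {d : measure_display} {T : measurableType d} {R : realType}.
Variable P : probability T R.
Variables (I : finType) (Y : I -> T -> bool).
Hypothesis mY : forall i, measurable [set t | Y i t].

Lemma pattern_eqE (S : {set I}) : [set t | [set i | Y i t]%SET = S] =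
  \bigcap_i (if i \in S then [set t | Y i t] else ~` [set t | Y i t]).
Proof.
apply/seteqP; split=> t /=.
  by move=> <- i _; rewrite inE; case: ifPn => //= /negP.
move=> SY; apply/setP => i; rewrite inE; have := SY i Logic.I.
by case: ifPn => //= _ /negP/negbTE.
Qed.

Lemma measurable_pattern_eq (S : {set I}) :
  measurable [set t | [set i | Y i t]%SET = S].
Proof. exact: (@measurable_pattern _ T I Y [set S' | S' = S]). Qed.

Lemma sum_pr_pattern :
  \sum_(S : {set I}) pr P [set t | [set i | Y i t]%SET = S] = 1.
Proof.
apply: EFin_inj; rewrite -sumEFin.
under eq_bigr do rewrite -(prE P (measurable_pattern_eq _)).
rewrite -(probability_setT P) -[index_enum _]/(index_enum _) fsbig_seq ?index_enum_uniq//.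
rewrite -measure_fin_bigcup//.
- congr (P _); apply/seteqP; split => // t _.
  by exists [set i | Y i t]%SET => //=; rewrite mem_index_enum.
- by apply/trivIsetP => S S' _ _ /eqP SS'; apply/seteqP; split=> t //= [->].
- by move=> S _; exact: measurable_pattern_eq.
Qed.

(* Markov's inequality for [2 ^- (number of events that occur)]. *)
Lemma chernoff_lower (a : R) (m : nat) :
  (forall S : {set I},
    pr P (\bigcap_i (if i \in S then [set t | Y i t] else ~` [set t | Y i t]))
    = \prod_i (if i \in S then pr P [set t | Y i t]
                else 1 - pr P [set t | Y i t])) ->
  (forall i, a <= pr P [set t | Y i t]) ->
  pr P [set t | (#|[set i | Y i t]%SET| < m)%N] <=
    2 ^+ m * expR (- (#|I|%:R * a / 2)).
Proof.
move=> indep aY; set p := fun i => pr P [set t | Y i t].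
have p0 i : 0 <= p i by exact: pr_ge0.
have p1 i : p i <= 1.
  by rewrite -(pr_setT P); exact: le_pr.
apply: (@le_trans _ _ (\sum_(S : {set I} | (#|S| < m)%N)
    pr P [set t | [set i | Y i t]%SET = S])).
  apply: union_bound.
  - exact: (@measurable_pattern _ T I Y [set S : {set I} | (#|S| < m)%N]).
  - by move=> S _; exact: measurable_pattern_eq.
  - by move=> t /= tm; exists [set i | Y i t]%SET.
(* For [#|S| < m] the factor [2^(m - #|S|)] is at least 1; it halves the weight of each event that
   occurs, and the sum may then run over all [S]. *)
apply: (@le_trans _ _ (\sum_(S : {set I}) 2 ^+ m *
    \prod_i (if i \in S then p i / 2 else 1 - p i))).
  rewrite [leRHS](bigID (fun S : {set I} => (#|S| < m)%N))/= ler_wpDr//.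
    apply: sumr_ge0 => S _; rewrite mulr_ge0 ?exprn_ge0//.
    apply: prodr_ge0 => i _; case: ifP => _; first by rewrite divr_ge0.
    by rewrite subr_ge0.
  apply: ler_sum => S Sm; rewrite pattern_eqE indep.
  have -> : \prod_i (if i \in S then p i / 2 else 1 - p i) =
            2^-1 ^+ #|S| * \prod_i (if i \in S then p i else 1 - p i).
    rewrite -prodr_const [X in _ = X * _]big_mkcond/= -big_split/=.
    by apply: eq_bigr => i _; case: ifP => _; rewrite ?mul1r// mulrC.
  rewrite mulrA ler_peMl//.
    by apply: prodr_ge0 => i _; case: ifP => _; rewrite ?subr_ge0 ?p1 ?pr_ge0.
  rewrite exprVn -[X in _ <= X]/(2 ^+ m / 2 ^+ #|S|) ler_pdivlMr ?exprn_gt0//.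
  by rewrite mul1r ler_eXn2l ?ltr1n// ltnW.
rewrite -mulr_sumr ler_wpM2l ?exprn_ge0//.
(* Over all [S] the sum factorises, with factors [p i / 2 + (1 - p i) = 1 - p i / 2], at most
   [expR (- (a / 2))]. *)
rewrite -(@bigA_distr _ 0 1 *%R +%R)/=.
apply: (@le_trans _ _ (\prod_(i : I) expR (- (a / 2)))).
  apply: ler_prod => i _; apply/andP; split.
    by have := p0 i; have := p1 i; lra.
  apply: le_trans (expR_ge1Dx _); have := aY i; rewrite -/(p i); lra.
rewrite prodr_const -expRM_natl -mulr_natl le_eqVlt; apply/orP; left; apply/eqP.
by congr expR; lra.
Qed.

(* Sum over the set of bad indices, weighting each term by a power of [y]. *)
Lemma few_good_bound (x y : R) (h : nat) : 0 <= x -> 1 <= y ->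
  (h <= #|I|)%N ->
  (forall S : {set I}, pr P [set t | [forall i in S, ~~ Y i t]] <= x ^+ #|S|) ->
  pr P [set t | (#|[set i | Y i t]%SET| < h)%N] <= y ^+ h * (y^-1 + x) ^+ #|I|.
Proof.
move=> x0 y1 hI xS; have y0 : 0 < y by exact: lt_le_trans y1.
have mS (S : {set I}) : measurable [set t | [forall i in S, ~~ Y i t]].
  rewrite (_ : mkset _ = [set t | (fun S' : {set I} =>
      [forall i in S, i \notin S']) [set i | Y i t]%SET]).
    exact: (@measurable_pattern _ T I Y (fun S' => [forall i in S, i \notin S'])).
  apply/seteqP; split=> t /= /forall_inP SY; apply/forall_inP => i /SY;
  by rewrite !inE.
apply: (@le_trans _ _ (\sum_(S : {set I} | (#|I| - h <= #|S|)%N)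
    pr P [set t | [forall i in S, ~~ Y i t]])).
  apply: union_bound => //.
  - exact: (@measurable_pattern _ T I Y [set S : {set I} | (#|S| < h)%N]).
  - move=> t /= th; exists (~: [set i | Y i t])%SET.
      by rewrite cardsCs finset.setCK cardsE leq_sub2l// ltnW // -cardsE.
    by apply/forall_inP => i; rewrite !inE.
(* The extra factor [y^(h + #|S| - #|I|)] is at least 1 for the sets kept so far; over all [S] the
   sum is a binomial expansion. *)
apply: (@le_trans _ _ (\sum_(S : {set I}) y ^+ h / y ^+ #|I| * (x * y) ^+ #|S|)).
  rewrite [leRHS](bigID (fun S : {set I} => (#|I| - h <= #|S|)%N))/= ler_wpDr//.
    by apply: sumr_ge0 => S _; rewrite !mulr_ge0 ?exprn_ge0 ?invr_ge0 ?mulr_ge0 ?exprn_ge0// ltW.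
  apply: ler_sum => S Sm; apply: le_trans (xS S) _.
  rewrite exprMn mulrCA ler_peMr ?exprn_ge0// mulrAC -exprD.
  rewrite ler_pdivlMr ?exprn_gt0// mul1r ler_weXn2l//.
  by rewrite -leq_subLR.
rewrite -mulr_sumr -mulrA ler_wpM2l ?exprn_ge0 ?(ltW y0)//.
rewrite (_ : \sum_(S : {set I}) _ = (x * y + 1) ^+ #|I|); last first.
  rewrite -prodr_const (@bigA_distr _ 0 1 *%R +%R)/=.
  by apply: eq_bigr => S _; rewrite -prodr_const -big_mkcond.
rewrite mulrC -expr_div_n le_eqVlt; apply/orP; left; apply/eqP; congr (_ ^+ _).
by rewrite mulrDl mulfK ?gt_eqF// mul1r addrC.
Qed.

End Concentration.

(** * Chains through a layered graph *)

Lemma exists_subset_card (V : finType) (A : {set V}) (m : nat) :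
  (m <= #|A|)%N -> exists2 B : {set V}, B \subset A & #|B| = m.
Proof.
move=> /card_geqP[s [us ss sA]]; exists [set x in s]%SET.
  by apply/fintype.subsetP => x; rewrite inE => /sA.
by rewrite cardsE -ss; exact/card_uniqP.
Qed.

Section LayeredGraph.
Variables (V : finType) (ok : rel V) (D : nat -> {set V}) (K : nat)
  (s : nat -> nat).

(** The values of [x] outside the range from [k] to [l] are arbitrary, so that chains can be glued
    by an [if] on the index. *)
Definition chain (k l : nat) (x : nat -> V) : Prop :=
  (forall j, (k <= j <= l)%N -> x j \in D j) /\
  (forall j, (k <= j < l)%N -> ok (x j) (x j.+1)).

(** Only sets of exactly [s i] vertices have to expand: a neighbourhood is trimmed to [s i.+1]
    vertices before the next step, which keeps the sets in the union bounds small. *)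
Definition expands_forward (k : nat) : Prop :=
  forall i (A : {set V}), (i < K)%N -> A \subset D k -> #|A| = s i ->
    (s i.+1 <= #|[set v in D k.+1 | [exists u in A, ok u v]]%SET|)%N.

Definition expands_backward (k : nat) : Prop :=
  forall i (B : {set V}), (i < K)%N -> B \subset D k.+1 -> #|B| = s i ->
    (s i.+1 <= #|[set u in D k | [exists v in B, ok u v]]%SET|)%N.

Definition joins (k : nat) : Prop :=
  forall A B : {set V}, A \subset D k -> B \subset D k.+1 ->
    #|A| = s K -> #|B| = s K ->
    exists u v, [/\ u \in A, v \in B & ok u v].

Lemma eq_chain k l x y : (forall j, (k <= j <= l)%N -> x j = y j) ->
  chain k l x -> chain k l y.
Proof.
move=> xy [xD xok]; split=> j kj; first by rewrite -xy//; exact: xD.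
by rewrite -!xy; [exact: xok|lia|lia].
Qed.

Lemma chain_trans k m l x : chain k m x -> chain m l x -> chain k l x.
Proof.
move=> [xD xok] [yD yok]; split=> j kj; case: (leqP j m) => jm.
- by apply: xD; lia.
- by apply: yD; lia.
- case: (ltnP j m) => jm'; first by apply: xok; lia.
  by apply: yok; lia.
- by apply: yok; lia.
Qed.

Lemma chain1 k x : x k \in D k -> x k.+1 \in D k.+1 -> ok (x k) (x k.+1) ->
  chain k k.+1 x.
Proof.
move=> xk xk1 okx; split=> j.
  by rewrite leq_eqVlt => /andP[/orP[/eqP<-//|kj] jk]; have -> : j = k.+1 by lia.
by move=> kj; have -> : j = k by lia.
Qed.

Hypothesis s0 : s 0 = 1%N.

Lemma grow_forward k u i : u \in D k -> (i <= K)%N ->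
  (forall j, (j < i)%N -> expands_forward (k + j)) ->
  exists A : {set V}, [/\ A \subset D (k + i)%N, #|A| = s i &
    forall v, v \in A -> exists x, [/\ chain k (k + i) x, x k = u &
      x (k + i)%N = v]].
Proof.
move=> uD; elim: i => [|i IH] iK exp.
  exists [set u]%SET; rewrite addn0 finset.sub1set cards1 s0; split=> // v /finset.set1P->.
  exists (fun=> u); split=> //; split=> j; last by lia.
  by move=> kj; have -> : j = k by lia.
have [||A [AD As Ax]] := IH; [exact: ltnW|by move=> j ji; apply: exp; lia|].
have [//|B BN Bs] := exists_subset_card (exp i _ i A iK AD As).
exists B; rewrite addnS; split=> //.
  by apply: (fintype.subset_trans BN); apply/fintype.subsetP => v; rewrite inE => /andP[].
move=> v /(fintype.subsetP BN); rewrite inE => /andP[vD /exists_inP[w wA okwv]].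
have [x [xc xk xi]] := Ax w wA.
exists (fun j => if (j <= k + i)%N then x j else v); split.
- apply: (@chain_trans _ (k + i)%N).
    by apply: eq_chain xc => j /andP[_ ->].
  by apply: chain1; rewrite ?leqnn ?ltnn ?xi// (fintype.subsetP AD).
- by rewrite leq_addr.
- by rewrite ltnn.
Qed.

(** The layers now decrease, so the induction on [i] generalises [k]: the induction hypothesis gives
    the set in layer [k.+1], and the last enlargement takes place at offset 0. *)
Lemma grow_backward k v i : v \in D (k + i)%N -> (i <= K)%N ->
  (forall j, (j < i)%N -> expands_backward (k + j)) ->
  exists A : {set V}, [/\ A \subset D k, #|A| = s i &
    forall u, u \in A -> exists x, [/\ chain k (k + i) x, x k = u &
      x (k + i)%N = v]].
Proof.
elim: i k => [|i IH] k; rewrite ?addn0 => vD iK exp.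
  exists [set v]%SET; rewrite finset.sub1set cards1 s0; split=> // u /finset.set1P->.
  exists (fun=> v); split=> //; split=> j; last by lia.
  by move=> kj; have -> : j = k by lia.
have [|||A [AD As Ax]] := IH k.+1; [by rewrite addSnnS|exact: ltnW| |].
  by move=> j ji; rewrite addSnnS; apply: exp.
have := exp 0%N isT i A iK; rewrite addn0 => /(_ AD As) /exists_subset_card[B BN Bs].
exists B; split=> //.
  by apply: (fintype.subset_trans BN); apply/fintype.subsetP => u; rewrite inE => /andP[].
move=> u /(fintype.subsetP BN); rewrite inE => /andP[uD /exists_inP[w wA okuw]].
have [x [xc xk xi]] := Ax w wA.
exists (fun j => if (j <= k)%N then u else x j); split.
- rewrite addnS -addSn; apply: (@chain_trans _ k.+1).
    by apply: chain1; rewrite ?leqnn ?ltnn ?xk// (fintype.subsetP AD).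
  by apply: eq_chain xc => j kj; rewrite ifF//; lia.
- by rewrite leqnn.
- by rewrite -addSnnS; case: ifP => //; lia.
Qed.

(** The length [2K + 1] consists of [K] steps forward from [u], one joining edge, and [K] steps back
    from [v]. *)
Lemma link k u v : u \in D k -> v \in D (k + K.*2.+1)%N ->
  (forall j, (j < K)%N -> expands_forward (k + j)) ->
  (forall j, (j < K)%N -> expands_backward (k + K.+1 + j)) ->
  joins (k + K) ->
  exists x, [/\ chain k (k + K.*2.+1) x, x k = u & x (k + K.*2.+1)%N = v].
Proof.
move=> uD vD fw bw join.
have [A [AD As Ax]] := grow_forward uD (leqnn K) fw.
have eqk : (k + K.*2.+1 = k + K.+1 + K)%N by lia.
rewrite eqk in vD *.
have [B [BD Bs Bx]] := grow_backward vD (leqnn K) bw.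
rewrite addnS in BD.
have [a [b [aA bB okab]]] := join A B AD BD As Bs.
have [x [xc xk xa]] := Ax a aA; have [y [yc yb yv]] := Bx b bB.
pose z j := if (j <= k + K)%N then x j else y j.
have zc : chain (k + K) (k + K.+1) z.
  rewrite addnS; apply: chain1; rewrite /z ?leqnn ?ltnn ?xa -?addnS ?yb//.
  - by rewrite (fintype.subsetP AD).
  - by rewrite addnS (fintype.subsetP BD).
exists z; split.
- apply: (@chain_trans _ (k + K)%N).
    by apply: eq_chain xc => j /andP[_ jk]; rewrite /z jk.
  apply: chain_trans zc _.
  by apply: eq_chain yc => j kj; rewrite /z ifF//; lia.
- by rewrite /z leq_addr.
- by rewrite /z ifF//; lia.
Qed.

Variables (J : nat) (o1 o2 : V) (a b : nat -> V).
Let period := K.*2.+2.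
Let last_layer := (J * period + K.*2.+1)%N.
Hypotheses (o1D : o1 \in D 0) (o2D : o2 \in D last_layer).
Hypothesis fw : forall k, (k.+1 < last_layer)%N -> expands_forward k.
Hypothesis bw : forall k, (0 < k < last_layer)%N -> expands_backward k.
Hypothesis join : forall k, (0 < k)%N -> (k.+1 < last_layer)%N -> joins k.
Hypothesis K_gt0 : (0 < K)%N.
Hypothesis abP : forall j, (j < J)%N ->
  [/\ a j \in D (j * period + K.*2.+1), b j \in D (j.+1 * period) &
      ok (a j) (b j)].

Lemma link_stage j u v : (j <= J)%N -> u \in D (j * period) ->
  v \in D (j * period + K.*2.+1) ->
  exists x, [/\ chain (j * period) (j * period + K.*2.+1) x,
    x (j * period)%N = u & x (j * period + K.*2.+1)%N = v].
Proof.
move=> jJ uD vD; have jp : (j * period <= J * period)%N by rewrite leq_mul2r jJ orbT.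
apply: link => //.
- by move=> i iK; apply: fw; rewrite /last_layer; lia.
- by move=> i iK; apply: bw; rewrite /last_layer; lia.
- by apply: join; rewrite /last_layer; lia.
Qed.

(** A period is a link of [2K + 1] steps followed by the prescribed edge from [a j] to [b j]. Any
    two vertices of its end layers can be linked, so stages are appended one at a time. *)
Lemma chain_stages m : (m <= J)%N -> exists x, [/\ chain 0 (m * period) x,
  x 0 = o1 & forall j, (j < m)%N ->
    x (j * period + K.*2.+1)%N = a j /\ x (j.+1 * period)%N = b j].
Proof.
elim: m => [|m IH] mJ.
  exists (fun=> o1); split=> //; split=> j; last by lia.
  by case: j.
have [x [xc x0 xab]] := IH (ltnW mJ).
have [aD bD okab] := abP mJ.
have xm : x (m * period)%N \in D (m * period) by apply: xc.1; rewrite leqnn.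
have [y [yc ym ya]] := link_stage (ltnW mJ) xm aD.
pose l := (m * period + K.*2.+1)%N.
have l1 : (m.+1 * period = l.+1)%N by rewrite /l /period mulSn; lia.
pose z j := if (j <= m * period)%N then x j else y j.
have zc : chain 0 l z.
  apply: (@chain_trans _ (m * period)%N).
    by apply: eq_chain xc => j /andP[_ jm]; rewrite /z jm.
  apply: eq_chain yc => j /andP[mj _]; rewrite /z; case: ifP => // jm.
  by have -> : j = (m * period)%N by lia.
have zl : z l = a m by rewrite /z -ya ifF// /l; lia.
pose z' j := if (j <= l)%N then z j else b m.
exists z'; split.
- rewrite l1; apply: (@chain_trans _ l).
    by apply: eq_chain zc => j /andP[_ jl]; rewrite /z' jl.
  by apply: chain1; rewrite /z' ?leqnn ?ltnn ?zl// -l1.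
- by rewrite /z' /z /= x0.
- move=> j; rewrite ltnS leq_eqVlt => /orP[/eqP->|jm].
    by rewrite /z' -/l leqnn zl l1 ltnn.
  have [xa xb] := xab j jm.
  have jl : (j.+1 * period <= m * period)%N by rewrite leq_mul2r jm orbT.
  have jl' : (j.+1 * period = j * period + period)%N by rewrite mulSn addnC.
  have le1 : (j * period + K.*2.+1 <= m * period)%N by rewrite /period in jl jl' *; lia.
  have le2 : (m * period <= l)%N by rewrite /l leq_addr.
  rewrite /z' (leq_trans le1 le2) (leq_trans jl le2) /z le1 jl.
  by split.
Qed.

Lemma chain_through : exists x, [/\ chain 0 last_layer x, x 0 = o1,
  x last_layer = o2 & forall j, (j < J)%N ->
    x (j * period + K.*2.+1)%N = a j /\ x (j.+1 * period)%N = b j].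
Proof.
have [x [xc x0 xab]] := chain_stages (leqnn J).
have xJ : x (J * period)%N \in D (J * period) by apply: xc.1; rewrite leqnn.
have [y [yc yJ yo]] := link_stage (leqnn J) xJ o2D.
exists (fun j => if (j <= J * period)%N then x j else y j); split.
- apply: (@chain_trans _ (J * period)%N).
    by apply: eq_chain xc => j /andP[_ jJ]; rewrite jJ.
  apply: eq_chain yc => j /andP[Jj _]; case: ifP => // jJ.
  by have -> : j = (J * period)%N by lia.
- by rewrite leq0n.
- by rewrite ifF ?yo// /last_layer; lia.
move=> j jJ; have [xa xb] := xab j jJ.
have jl : (j.+1 * period <= J * period)%N by rewrite leq_mul2r jJ orbT.
have jl' : (j.+1 * period = j * period + period)%N by rewrite mulSn addnC.
have le1 : (j * period + K.*2.+1 <= J * period)%N by rewrite /period in jl jl' *; lia.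
by rewrite le1 jl.
Qed.

End LayeredGraph.

(** * Union bounds over vertex sets *)

Section EdgeCounts.
Variable V : finType.

Definition cross (A B : {set V}) : {set {set V}} :=
  [set [set u; v]%SET | u in A, v in B]%SET.

Lemma crossP (A B : {set V}) (Q : {set V} -> bool) :
  (forall u v, u \in A -> v \in B -> Q [set u; v]%SET) ->
  [forall e in cross A B, Q e].
Proof. by move=> QAB; apply/forall_inP => _ /imset2P[u v uA vB ->]; exact: QAB. Qed.

Lemma set2_inj_disjoint (A B : {set V}) (u u' v v' : V) :
  {in A, forall x, x \notin B} -> u \in A -> u' \in A -> v \in B -> v' \in B ->
  [set u; v]%SET = [set u'; v']%SET -> u = u' /\ v = v'.
Proof.
move=> AB uA uA' vB vB' /setP uv; split.
  have := uv u; rewrite !finset.in_set2 eqxx/= => /esym/orP[/eqP//|/eqP uv'].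
  by move: vB'; rewrite -uv' (negbTE (AB _ uA)).
have := uv v; rewrite !finset.in_set2 eqxx orbT => /esym/orP[/eqP vu'|/eqP//].
by move: (AB _ uA'); rewrite -vu' vB.
Qed.

Lemma card_cross (A B : {set V}) : {in A, forall x, x \notin B} ->
  #|cross A B| = (#|A| * #|B|)%N.
Proof.
move=> AB; rewrite /cross curry_imset2X card_in_imset ?cardsX//.
move=> [u v] [u' v']; rewrite !finset.in_setX /= => /andP[uA vB] /andP[uA' vB'].
by move=> /(set2_inj_disjoint AB uA uA' vB vB')[-> ->].
Qed.

Lemma card_small_sets (m : nat) :
  (#|[set B : {set V} | (#|B| <= m)%N]%SET| <= #|V|.+1 ^ m)%N.
Proof.
pose f (g : {ffun 'I_m -> option V}) := [set v | Some v \in codom g]%SET.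
apply: (@leq_trans #|f @: [set: {ffun 'I_m -> option V}]%SET|); last first.
  by rewrite (leq_trans (leq_imset_card _ _))// cardsT card_ffun card_option card_ord.
apply/subset_leq_card/fintype.subsetP => B; rewrite inE => Bm.
apply/imsetP; exists [ffun i : 'I_m => onth (enum B) i]; rewrite ?inE//.
apply/setP => v; rewrite inE; apply/idP/codomP => [vB|[i]].
  have vm : (index v (enum B) < m)%N.
    by rewrite (leq_trans _ Bm)// cardE index_mem mem_enum.
  exists (Ordinal vm); rewrite ffunE/=; apply/esym/eqP.
  by rewrite onthE (nth_map v) ?index_mem ?mem_enum// nth_index ?mem_enum.
rewrite ffunE => /esym iv; rewrite -(onth_nth v v (enum B) i iv).
by rewrite -mem_enum mem_nth// -onthTE iv.
Qed.

End EdgeCounts.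

(** * Failure of expansion, of joining and of prescribed pairs of sets, from a bound on closed edge
    sets *)

Section WeightEvents.
Context {d : measure_display} {T : measurableType d} {R : realType}.
Variable P : probability T R.
Variables (V : finType) (edges : {set {set V}}) (U : {set V} -> T -> bool).
Hypothesis mU : forall e, measurable [set t | U e t].
Variable p : R.
Hypothesis p_ge0 : 0 <= p.
Hypothesis no_edge_bound : forall Q : {set {set V}}, Q \subset edges ->
  pr P [set t | [forall e in Q, ~~ U e t]] <= expR (- (p * #|Q|%:R)).

Definition open_edges (t : T) : {set {set V}} := [set e | U e t]%SET.

Definition set_adj (S : {set {set V}}) : rel V :=
  fun u v => [set u; v]%SET \in S.

Lemma measurable_open (Q : set {set {set V}}) :
  measurable [set t | Q (open_edges t)].
Proof. exact: measurable_pattern. Qed.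

Lemma measurable_closed (Q : {set {set V}}) :
  measurable [set t | [forall e in Q, ~~ U e t]].
Proof.
rewrite (_ : mkset _ = [set t | (fun S : {set {set V}} =>
    [forall e in Q, e \notin S]) (open_edges t)]).
  exact: (measurable_open (fun S : {set {set V}} => [forall e in Q, e \notin S])).
by apply/seteqP; split=> t /= /forall_inP SY; apply/forall_inP => i /SY;
  rewrite !inE.
Qed.

Let n2 : R := #|V|.+1%:R.

Lemma sum_pairs_bound (s s' : nat) (Q : pred ({set V} * {set V}))
    (F : {set V} * {set V} -> R) (c : R) : 0 <= c ->
  (forall AB, Q AB -> (#|AB.1| <= s)%N && (#|AB.2| <= s')%N) ->
  (forall AB, Q AB -> F AB <= c) ->
  \sum_(AB | Q AB) F AB <= n2 ^+ (s + s') * c.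
Proof.
move=> c0 Qs Fc.
apply: (@le_trans _ _ (\sum_(AB | Q AB) c)); first exact: ler_sum.
rewrite sumr_const -[X in X <= _]mulr_natl ler_wpM2r// /n2 -natrX ler_nat.
pose small m := [set B : {set V} | (#|B| <= m)%N]%SET.
apply: (@leq_trans #|finset.setX (small s) (small s')|).
  apply/subset_leq_card/fintype.subsetP => AB /Qs/andP[As Bs].
  by rewrite !inE As.
by rewrite cardsX expnD leq_mul// card_small_sets.
Qed.

(** If the set [B] of neighbours of [A] is too small, no edge between [A] and [Y] minus [B] is open,
    and there are at least [s * (M - s')] such edges. The union bound runs over the pairs
    [(A, B)]. *)
Lemma expansion_failure (X Y : {set V}) (s s' M : nat) :
  {in X, forall x, x \notin Y} -> cross X Y \subset edges -> (M <= #|Y|)%N ->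
  pr P [set t | exists A : {set V}, [/\ A \subset X, #|A| = s &
      (#|[set v in Y | [exists u in A, set_adj (open_edges t) u v]]%SET| < s')%N]]
  <= n2 ^+ (s + s') * expR (- (p * (s * (M - s'))%:R)).
Proof.
move=> XY eXY MY.
pose F (AB : {set V} * {set V}) :=
  [set t | [forall e in cross AB.1 (finset.setD Y AB.2), ~~ U e t]].
pose Q (AB : {set V} * {set V}) :=
  [&& AB.1 \subset X, #|AB.1| == s & (#|AB.2| <= s')%N].
apply: (@le_trans _ _ (\sum_(AB | Q AB) pr P (F AB))).
  apply: union_bound.
  - exact: (measurable_open (fun S => exists A : {set V}, [/\ A \subset X, #|A| = s &
      (#|[set v in Y | [exists u in A, set_adj S u v]]%SET| < s')%N])).
  - by move=> i _; exact: measurable_closed.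
  - move=> t [A [AX As Bs]].
    exists (A, [set v in Y | [exists u in A, set_adj (open_edges t) u v]]%SET).
      by rewrite /Q/= AX As eqxx ltnW.
    apply: crossP => u v uA; rewrite !inE => /andP[+ vY].
    by rewrite vY/= => /exists_inPn/(_ u uA); rewrite /set_adj inE.
apply: sum_pairs_bound => [|AB|[A B]]; first exact: expR_ge0.
  by move=> /and3P[_ /eqP-> ->]; rewrite leqnn.
move=> /and3P[/= AX /eqP As Bs].
have AXs := fintype.subsetP AX.
apply: le_trans (no_edge_bound _) _ => /=.
  apply: (fintype.subset_trans _ eXY); apply: imset2S => //.
  by apply/fintype.subsetP => v; rewrite inE => /andP[].
rewrite ler_expR lerN2 ler_wpM2l// ler_nat card_cross.
  rewrite As leq_mul2l; apply/orP; right.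
  rewrite cardsD leq_sub// (leq_trans _ Bs)//.
  by apply/subset_leq_card/fintype.subsetP => v; rewrite inE => /andP[].
by move=> u /AXs/XY uY; rewrite inE (negbTE uY) andbF.
Qed.

Lemma join_failure (X Y : {set V}) (s : nat) :
  {in X, forall x, x \notin Y} -> cross X Y \subset edges ->
  pr P [set t | exists A B : {set V}, [/\ A \subset X, B \subset Y, #|A| = s,
      #|B| = s & forall u v, u \in A -> v \in B -> ~~ set_adj (open_edges t) u v]]
  <= n2 ^+ (s + s) * expR (- (p * (s * s)%:R)).
Proof.
move=> XY eXY.
pose F (AB : {set V} * {set V}) := [set t | [forall e in cross AB.1 AB.2, ~~ U e t]].
pose Q (AB : {set V} * {set V}) :=
  [&& AB.1 \subset X, AB.2 \subset Y, #|AB.1| == s & #|AB.2| == s].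
apply: (@le_trans _ _ (\sum_(AB | Q AB) pr P (F AB))).
  apply: union_bound.
  - exact: (measurable_open (fun S => exists A B : {set V},
      [/\ A \subset X, B \subset Y, #|A| = s, #|B| = s &
      forall u v, u \in A -> v \in B -> ~~ set_adj S u v])).
  - by move=> i _; exact: measurable_closed.
  - move=> t [A [B [AX BY As Bs AB]]]; exists (A, B).
      by rewrite /Q/= AX BY As Bs eqxx.
    by apply: crossP => u v uA vB; have := AB u v uA vB; rewrite /set_adj inE.
apply: sum_pairs_bound => [|AB|[A B]]; first exact: expR_ge0.
  by move=> /and4P[_ _ /eqP-> /eqP->]; rewrite leqnn.
move=> /and4P[/= AX BY /eqP As /eqP Bs].
have AXs := fintype.subsetP AX; have BYs := fintype.subsetP BY.
apply: le_trans (no_edge_bound _) _ => /=.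
  by apply: (fintype.subset_trans _ eXY); exact: imset2S.
rewrite ler_expR lerN2 ler_wpM2l// ler_nat card_cross ?As ?Bs//.
by move=> u /AXs/XY; apply: contra => /BYs.
Qed.

(** The edge sets of distinct indices are disjoint, so failure at all indices of [S] closes at least
    [#|S| * M * M] edges. This geometric bound in [#|S|] takes the place of independence of the
    stages. *)
Lemma no_edge_family_bound (I : finType) (X Y : I -> {set V}) (M : nat) :
  (forall i, {in X i, forall x, x \notin Y i}) ->
  (forall i, cross (X i) (Y i) \subset edges) ->
  (forall i, M <= #|X i|)%N -> (forall i, M <= #|Y i|)%N ->
  (forall i j e, e \in cross (X i) (Y i) -> e \in cross (X j) (Y j) -> i = j) ->
  forall S : {set I},
    pr P [set t | [forall i in S, ~~ [exists e in cross (X i) (Y i), U e t]]]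
    <= expR (- (p * (M * M)%:R)) ^+ #|S|.
Proof.
move=> XY eXY MX MY dis S.
pose F i := if i \in S then cross (X i) (Y i) else finset.set0.
pose Q := (\bigcup_i F i)%SET.
have -> : [set t | [forall i in S, ~~ [exists e in cross (X i) (Y i), U e t]]] =
          [set t | [forall e in Q, ~~ U e t]].
  apply/seteqP; split=> t /= /forall_inP H; apply/forall_inP.
    move=> e /bigcupP[i _]; rewrite /F; case: ifPn => [iS eX|_]; last by rewrite finset.in_set0.
    by have /exists_inPn/(_ e eX) := H i iS.
  move=> i iS; apply/exists_inPn => e eX; apply: H.
  by apply/bigcupP; exists i => //; rewrite /F iS.
apply: le_trans (no_edge_bound _) _.
  apply/fintype.subsetP => e /bigcupP[i _]; rewrite /F; case: ifPn => [iS|_].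
    exact: (fintype.subsetP (eXY i)).
  by rewrite finset.in_set0.
rewrite -expRM_natl ler_expR mulrN lerN2 mulrCA ler_wpM2l// -natrM ler_nat.
rewrite -[#|Q|]sum1_card (@finset.partition_disjoint_bigcup _ _ _ _ addn)/=; last first.
  move=> i j ij; rewrite /F -finset.setI_eq0; apply/eqP/setP => e.
  rewrite finset.in_setI finset.in_set0.
  case: ifPn => iS; last by rewrite finset.in_set0.
  case: ifPn => jS; last by rewrite finset.in_set0 andbF.
  apply/negP => /andP[/dis h /h]; by move/eqP; rewrite (negbTE ij).
rewrite -sum_nat_const big_mkcond/= leq_sum// => i _.
rewrite sum1_card /F; case: ifP => // iS.
by rewrite card_cross// leq_mul.
Qed.

End WeightEvents.

Lemma crossC (V : finType) (A B : {set V}) : cross A B = cross B A.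
Proof.
by apply/setP => e; apply/imset2P/imset2P => -[u v uA vB ->];
  exists v u => //; rewrite finset.setUC.
Qed.

Section ExpanderFailure.
Context {d : measure_display} {T : measurableType d} {R : realType}.
Variable P : probability T R.
Variables (V : finType) (edges : {set {set V}}) (U : {set V} -> T -> bool).
Hypothesis mU : forall e, measurable [set t | U e t].
Variable p : R.
Hypothesis p_ge0 : 0 <= p.
Hypothesis no_edge_bound : forall Q : {set {set V}}, Q \subset edges ->
  pr P [set t | [forall e in Q, ~~ U e t]] <= expR (- (p * #|Q|%:R)).
Variables (D : nat -> {set V}) (K l M : nat) (s : nat -> nat) (lambda : R).
Hypothesis D_disj : forall k, (k < l)%N -> {in D k, forall x, x \notin D k.+1}.
Hypothesis D_edges : forall k, (k < l)%N -> cross (D k) (D k.+1) \subset edges.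
Hypothesis D_card : forall k, (0 < k < l)%N -> (M <= #|D k|)%N.
Hypothesis expand_rate : forall i, (i < K)%N ->
  #|V|.+1%:R ^+ (s i + s i.+1) * expR (- (p * (s i * (M - s i.+1))%:R))
    <= expR (- lambda).
Hypothesis join_rate :
  #|V|.+1%:R ^+ (s K + s K) * expR (- (p * (s K * s K)%:R)) <= expR (- lambda).

(** The ranges of [k] avoid the end layers, which will be the singletons of [O1] and [O2]: nothing
    can expand into them and no joining takes place there. Expanding out of them is allowed, since a
    link starts from one vertex. *)
Definition expander (S : {set {set V}}) : Prop :=
  [/\ forall k, (k.+1 < l)%N -> expands_forward (set_adj S) D K s k,
      forall k, (0 < k < l)%N -> expands_backward (set_adj S) D K s k &
      forall k, (0 < k)%N -> (k.+1 < l)%N -> joins (set_adj S) D K s k].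

(** Each of at most [l] positions contributes [K] forward expansions, [K] backward ones and one
    joining, whence the factor [K.*2.+1]. *)
Lemma expander_failure :
  pr P [set t | ~ expander (open_edges U t)] <= (l * K.*2.+1)%:R * expR (- lambda).
Proof.
pose F (ki : 'I_l * 'I_K) := [set t | exists A : {set V},
  [/\ A \subset D ki.1, #|A| = s ki.2 &
    (#|[set v in D ki.1.+1 | [exists u in A, set_adj (open_edges U t) u v]]%SET|
       < s ki.2.+1)%N]].
pose B (ki : 'I_l * 'I_K) := [set t | exists A : {set V},
  [/\ A \subset D ki.1.+1, #|A| = s ki.2 &
    (#|[set v in D ki.1 | [exists u in A, set_adj (open_edges U t) u v]]%SET|
       < s ki.2.+1)%N]].
pose G (k : 'I_l) := [set t | exists X Y : {set V}, [/\ X \subset D k,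
  Y \subset D k.+1, #|X| = s K, #|Y| = s K &
  forall u v, u \in X -> v \in Y -> ~~ set_adj (open_edges U t) u v]].
pose QF (ki : 'I_l * 'I_K) := (ki.1.+1 < l)%N.
pose QB (ki : 'I_l * 'I_K) := (0 < ki.1)%N.
have mO Q : measurable [set t | Q (open_edges U t)] by exact: measurable_open.
have mF ki : measurable (F ki).
  exact: (mO (fun S => exists A : {set V}, [/\ A \subset D ki.1, #|A| = s ki.2 &
    (#|[set v in D ki.1.+1 | [exists u in A, set_adj S u v]]%SET| < s ki.2.+1)%N])).
have mB ki : measurable (B ki).
  exact: (mO (fun S => exists A : {set V}, [/\ A \subset D ki.1.+1, #|A| = s ki.2 &
    (#|[set v in D ki.1 | [exists u in A, set_adj S u v]]%SET| < s ki.2.+1)%N])).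
have mG k : measurable (G k).
  exact: (mO (fun S => exists X Y : {set V}, [/\ X \subset D k, Y \subset D k.+1,
    #|X| = s K, #|Y| = s K & forall u v, u \in X -> v \in Y -> ~~ set_adj S u v])).
have adjC t u v : set_adj (open_edges U t) u v = set_adj (open_edges U t) v u.
  by rewrite /set_adj finset.setUC.
have -> : (l * K.*2.+1)%:R * expR (- lambda) =
    (l * K)%:R * expR (- lambda) + (l * K)%:R * expR (- lambda) +
    l%:R * expR (- lambda).
  by rewrite -!mulrDl -!natrD; congr (_%:R * _); lia.
pose I := ('I_l * 'I_K + 'I_l * 'I_K + 'I_l)%type.
pose E (i : I) := match i with inl (inl ki) => F ki | inl (inr ki) => B ki
  | inr k => G k end.
pose Q (i : I) := match i with inl (inl ki) => QF ki | inl (inr ki) => QB ki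
  | inr k => true end.
have union : pr P [set t | ~ expander (open_edges U t)] <= \sum_(i | Q i) pr P (E i).
  apply: union_bound.
  - exact: (mO (fun S => ~ expander S)).
  - by case=> [[ki|ki]|k] _ /=; [exact: mF|exact: mB|exact: mG].
  move=> t nexp; apply: contrapT => noE; apply: nexp; split.
  - move=> k kl i A iK AD As; rewrite leqNgt; apply/negP => bad; apply: noE.
    have kl' : (k < l)%N by lia.
    by exists (inl (inl (Ordinal kl', Ordinal iK))) => //; exists A.
  - move=> k /andP[k0 kl] i A iK AD As; rewrite leqNgt; apply/negP => bad; apply: noE.
    exists (inl (inr (Ordinal kl, Ordinal iK))) => //; exists A; split => //=.
    rewrite (_ : [set v in D k | _]%SET = [set u in D k |
      [exists v in A, set_adj (open_edges U t) u v]]%SET)//; apply/setP => v.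
    rewrite !inE; congr (_ && _).
    by apply: eq_existsb => u; rewrite adjC.
  - move=> k k0 kl X Y XD YD Xs Ys; apply: contrapT => bad; apply: noE.
    have kl' : (k < l)%N by lia.
    exists (inr (Ordinal kl')) => //; exists X, Y; split=> // u v uX vY.
    by apply/negP => adj; apply: bad; exists u, v.
apply: le_trans union _.
have e0 := expR_ge0 (- lambda).
rewrite big_sumType/= big_sumType/=.
have const (J : finType) (C : pred J) (g : J -> R) :
    (forall j, C j -> g j <= expR (- lambda)) ->
    \sum_(j | C j) g j <= #|J|%:R * expR (- lambda).
  move=> gl; apply: (@le_trans _ _ (\sum_(j | C j) expR (- lambda))).
    exact: ler_sum.
  by rewrite sumr_const -[leLHS]mulr_natl ler_wpM2r// ler_nat max_card.
have cI : #|{: 'I_l * 'I_K}| = (l * K)%N by rewrite card_prod !card_ord.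
apply: lerD; first rewrite -cI; first apply: lerD; first apply: const; last first.
- have -> : l%:R = #|'I_l|%:R :> R by rewrite card_ord.
  apply: const => k _; apply: le_trans join_rate.
  by apply: (join_failure mU p_ge0 no_edge_bound); [exact: D_disj|exact: D_edges].
- apply: const => -[k i] /= k0; apply: le_trans (expand_rate (ltn_ord i)).
  apply: (expansion_failure mU p_ge0 no_edge_bound).
  + by move=> x; apply: contraL => /(D_disj (ltn_ord k)).
  + by rewrite crossC; exact: D_edges.
  + by apply: D_card; rewrite ltn_ord andbT.
- move=> [k i] /= kl; apply: le_trans (expand_rate (ltn_ord i)).
  apply: (expansion_failure mU p_ge0 no_edge_bound).
  + exact: D_disj.
  + exact: D_edges.
  + exact: D_card.
Qed.

End ExpanderFailure.

(** * Cells and paths *)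

Section Layers.
Variables (n l : nat) (Z : {set 'I_n * 'I_l.+1}).

(* [Z] records the pairs (vertex, cell) such that the vertex lies in the cell. *)
Definition layer (k : nat) : {set vertex n} :=
  if k == 0%N then [set O1]%SET else if k == l then [set O2]%SET
  else [set v : vertex n | if v is inl i then (i, inord k) \in Z else false]%SET.

Definition single_cell : Prop :=
  forall i k k', (i, k) \in Z -> (i, k') \in Z -> k = k'.

Hypothesis Z_single : single_cell.
Hypothesis l_gt1 : (1 < l)%N.

Lemma O1_layer k : (O1 \in layer k) = (k == 0%N).
Proof.
rewrite /layer; case: eqVneq => [_|k0]; first by rewrite finset.set11.
by case: eqVneq => _; [rewrite finset.in_set1|rewrite inE].
Qed.

Lemma O2_layer k : (O2 \in layer k) = (k == l).
Proof.
rewrite /layer; have [->|k0] := eqVneq k 0%N.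
  by rewrite finset.in_set1; apply/esym/negbTE; lia.
by case: eqVneq => _; [rewrite finset.set11|rewrite inE].
Qed.

Lemma inl_layer i k : (inl i \in layer k) =
  [&& k != 0%N, k != l & (i, inord k) \in Z].
Proof.
rewrite /layer; have [->|k0] := eqVneq k 0%N; first by rewrite finset.in_set1.
by case: eqVneq => _; [rewrite finset.in_set1|rewrite inE].
Qed.

Lemma layer_inj v k k' : (k <= l)%N -> (k' <= l)%N ->
  v \in layer k -> v \in layer k' -> k = k'.
Proof.
move=> kl kl'; case: v => [i|[]].
- rewrite !inl_layer => /and3P[_ _ Zk] /and3P[_ _ Zk'].
  by have /(congr1 (@nat_of_ord _)) := Z_single Zk Zk'; rewrite !inordK.
- by rewrite -/O2 !O2_layer => /eqP-> /eqP->.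
- by rewrite -/O1 !O1_layer => /eqP-> /eqP->.
Qed.

Lemma layer_disj k : (k < l)%N -> {in layer k, forall x, x \notin layer k.+1}.
Proof.
move=> kl v vk; apply/negP => vk1.
by have := layer_inj (ltnW kl) kl vk vk1; lia.
Qed.

(** The only pair of distinct vertices that is not an edge is [O1], [O2]; these lie in layers 0 and
    [l], which are not consecutive since [l > 1]. *)
Lemma layer_edges k : (k < l)%N -> cross (layer k) (layer k.+1) \subset K2_edges n.
Proof.
move=> kl; apply/fintype.subsetP => _ /imset2P[u v uk vk ->].
have uv : u != v by apply: contraNneq (layer_disj kl uk) => ->.
rewrite inE cards2 uv/=; apply/eqP => /setP E.
have := E O1; rewrite !finset.in_set2 eqxx/= => /orP[] /eqP h1; last first.
  by move: vk; rewrite -h1 O1_layer.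
move: uk; rewrite -h1 O1_layer => /eqP k0.
have := E O2; rewrite !finset.in_set2 eqxx orbT -h1/= => /eqP h2.
by move: vk; rewrite -h2 O2_layer; lia.
Qed.

End Layers.

Section PathsThroughLayers.
Context {R : realType}.
Variables (n l : nat) (rho r zeta q w : R) (X : 'I_n -> R * R)
  (wt : {set vertex n} -> R).

(** Squares of side [rho / 2], one per interval of length [rho]: the gaps keep neighbouring cells at
    distance at least [rho / 2], while the largest distance is [sqrt 10 / 2 * rho], less than
    [2 * rho]. As [zeta = l * rho], the points [O1] and [O2] are corners of cells 0 and [l]. *)
Definition incell (k : nat) (x : R * R) : bool :=
  [&& k%:R * rho <= x.1, x.1 <= k%:R * rho + rho / 2, 0 <= x.2 & x.2 <= rho / 2].

Definition cell_pattern : {set 'I_n * 'I_l.+1} :=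
  [set ik : 'I_n * 'I_l.+1 | incell ik.2 (X ik.1)]%SET.

Hypotheses (rho_gt0 : 0 < rho) (rho_r : 2 * rho < r) (q_rho : q <= rho / 2).
Hypotheses (zetaE : zeta = l%:R * rho) (l_gt1 : (1 < l)%N).

Lemma incell_inj k k' x : incell k x -> incell k' x -> k = k'.
Proof.
have step a b : incell a x -> incell b x -> (a <= b)%N.
  move=> /and4P[ax _ _ _] /and4P[_ xb _ _]; rewrite -ltnS -(ltr_nat R) -natr1.
  rewrite -(ltr_pM2r rho_gt0) mulrDl mul1r (le_lt_trans ax)// (le_lt_trans xb)//.
  by rewrite ltrD2l; move: rho_gt0; lra.
by move=> kx kx'; apply/eqP; rewrite eqn_leq !step.
Qed.

Lemma cell_pattern_single : single_cell cell_pattern.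
Proof.
by move=> i k k'; rewrite !inE => /incell_inj/[apply]; exact: val_inj.
Qed.

Lemma incell_dist k x y : incell k x -> incell k.+1 y ->
  (q <= euclid_dist x y) && (euclid_dist x y < r).
Proof.
move=> /and4P[x1 x2 x3 x4] /and4P[+ + y3 y4]; rewrite -natr1 => y1 y2.
have rho0 := rho_gt0; have rhor := rho_r.
have d1 : rho / 2 <= y.1 - x.1 by nra.
have d2 : y.1 - x.1 <= 3 / 2 * rho by nra.
apply/andP; split.
  apply: (le_trans q_rho); rewrite -[leLHS]ger0_norm -?sqrtr_sqr; last by lra.
  rewrite ler_wsqrtr//.
  have s1 : 0 <= (y.1 - x.1 - rho / 2) * (y.1 - x.1 + rho / 2).
    by rewrite mulr_ge0//; lra.
  have s2 := sqr_ge0 (x.2 - y.2); nra.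
rewrite -[ltRHS]ger0_norm -?sqrtr_sqr; last by lra.
have s1 : 0 <= (3 / 2 * rho - (y.1 - x.1)) * (3 / 2 * rho + (y.1 - x.1)).
  by rewrite mulr_ge0//; lra.
have s2 : 0 <= (rho / 2 - (y.2 - x.2)) * (rho / 2 + (y.2 - x.2)).
  by rewrite mulr_ge0//; lra.
have s3 : 0 < (r - 2 * rho) * (r + 2 * rho) by rewrite mulr_gt0//; lra.
have s4 : 0 < rho * rho by rewrite mulr_gt0.
have r2 : 0 < r ^+ 2 by rewrite exprn_gt0//; lra.
by rewrite ltr_sqrt//; nra.
Qed.

Lemma layer_incell k v : (k <= l)%N -> v \in layer cell_pattern k ->
  incell k (location zeta X v).
Proof.
have rho0 := rho_gt0; move=> kl; rewrite /layer; case: eqVneq => [->|k0].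
  rewrite finset.in_set1 => /eqP-> /=; rewrite /incell/=; apply/and4P; split; lra.
case: eqVneq => [->|k1].
  rewrite finset.in_set1 => /eqP-> /=; rewrite /incell/= zetaE.
  by apply/and4P; split; lra.
by rewrite inE; case: v => // i; rewrite inE/= inordK.
Qed.

Lemma path_map_iota (A : Type) (e : rel A) (x : nat -> A) a m :
  path e (x a) [seq x j | j <- iota a.+1 m] =
  all (fun j => e (x j) (x j.+1)) (iota a m).
Proof. by elim: m a => //= m IH a; rewrite IH. Qed.

Lemma zip_map_iota (A : Type) (x : nat -> A) a m :
  zip (x a :: [seq x j | j <- iota a.+1 m]) [seq x j | j <- iota a.+1 m] =
  [seq (x j, x j.+1) | j <- iota a m].
Proof. by elim: m a => //= m IH a; rewrite -IH. Qed.

Variables (S : {set {set vertex n}}) (x : nat -> vertex n).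
Hypotheses (S_wt : forall e, e \in S -> w <= wt e) (w_ge0 : 0 <= w).
Hypothesis x_chain : chain (set_adj S) (layer cell_pattern) 0 l x.
Hypotheses (x0 : x 0 = O1) (xl : x l = O2).

Lemma chain_max_weight (theta : R) : l%:R <= theta ->
  \sum_(j < l) wt [set x j; x j.+1]%SET <=
  max_weight r (location zeta X) wt theta q w.
Proof.
move=> ltheta; pose p := [seq x j | j <- iota 1 l].
have [xD xS] := x_chain.
have psz : size p = l by rewrite size_map size_iota.
have mem_iota0 j : j \in iota 0 l -> (j < l)%N by rewrite mem_iota.
have pathp : lqw_path r (location zeta X) wt theta q w p.
  rewrite /lqw_path psz ltheta/= /rgg_path -x0.
  have -> : x 0 :: p = [seq x j | j <- iota 0 l.+1] by [].
  rewrite map_inj_in_uniq ?iota_uniq; last first.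
    move=> i j; rewrite !mem_iota/= !add0n !ltnS => il jl xij.
    apply: (layer_inj cell_pattern_single l_gt1 il jl (xD i _)) => //.
    by rewrite xij; apply: xD.
  have -> : last (x 0) p = O2.
    rewrite /p (last_map x (iota 1 l) 0) -xl; congr x.
    by rewrite (last_nth 0%N) size_iota -[0%N :: _]/(iota 0 l.+1) nth_iota.
  have dist j : (j < l)%N -> (q <= euclid_dist (location zeta X (x j))
        (location zeta X (x j.+1))) &&
      (euclid_dist (location zeta X (x j)) (location zeta X (x j.+1)) < r).
    by move=> jl; apply: (@incell_dist j); apply: layer_incell => //;
      [exact: ltnW|apply: xD; lia|apply: xD; lia].
  rewrite eqxx/= /p !path_map_iota; apply/andP; split; apply/allP => j /mem_iota0 jl.
    have /andP[_ dr] := dist j jl; rewrite /rgg_adj dr andbT.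
    apply: (fintype.subsetP (layer_edges cell_pattern_single l_gt1 jl)).
    by apply: imset2_f; apply: xD; lia.
  have /andP[-> _]/= := dist j jl.
  by apply: S_wt; exact: xS.
have [p' _ [-> pmax]] := max_weightP (ex_intro _ p pathp).
apply: le_trans (pmax p pathp).
rewrite /path_weight -x0 /p zip_map_iota big_map.
have -> : iota 0 l = index_iota 0 l by rewrite /index_iota subn0.
by rewrite big_mkord.
Qed.

End PathsThroughLayers.

Lemma sum_ge_heavy (R : realType) (l J : nat) (g : nat -> R) (idx : nat -> nat)
    (H : {set 'I_J}) (alpha : R) :
  (forall j, (j < l)%N -> 0 <= g j) -> injective idx ->
  (forall j, (j < J)%N -> (idx j < l)%N) ->
  (forall j : 'I_J, j \in H -> alpha <= g (idx j)) ->
  #|H|%:R * alpha <= \sum_(j < l) g j.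
Proof.
move=> g0 idx_inj idx_lt gH.
pose f (j : 'I_J) : 'I_l := Ordinal (idx_lt j (ltn_ord j)).
have f_inj : injective f.
  by move=> i j /(congr1 (@nat_of_ord _))/=/idx_inj; exact: val_inj.
rewrite (bigID (fun j => j \in f @: H))/= ler_wpDr//.
  by apply: sumr_ge0 => j _; exact: g0.
rewrite big_imset/=; last by move=> i j _ _; exact: f_inj.
rewrite mulr_natl -sumr_const; apply: ler_sum => j jH; exact: gH.
Qed.

(** * The inverse ccdf *)

Section InverseCcdf.
Context {R : realType} (nu : probability R R).

Lemma inv_ccdf_ge0 (z : R) : 0 <= inv_ccdf nu z.
Proof.
(* By convention [sup] is 0 when the set is empty or unbounded. *)
rewrite /inv_ccdf; have [hs|/sup_out->//] := pselect (has_sup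
  [set x : R | 0 < x /\ ((z^-1)%:E <= ccdf_of nu x)%E]).
have [[x [x0 zx]] ub] := hs; apply: (le_trans (ltW x0)).
exact: ub_le_sup.
Qed.

(** The ray is closed because the ccdf may jump below [z^-1] at the supremum itself; continuity of
    the measure from above, along rays starting slightly to the left, gives the bound. Positivity
    rules out the default value of [sup]. *)
Lemma inv_ccdf_tail (z : R) : 0 < inv_ccdf nu z ->
  ((z^-1)%:E <= nu `[inv_ccdf nu z, +oo[%classic)%E.
Proof.
set H := inv_ccdf nu z => H0.
have hs : has_sup [set x : R | 0 < x /\ ((z^-1)%:E <= ccdf_of nu x)%E].
  apply: contrapT => /sup_out; rewrite -/(inv_ccdf nu z) -/H => H00.
  by rewrite H00 ltxx in H0.
pose F (m : nat) : set R := `]H - m.+1%:R^-1, +oo[%classic.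
have -> : `[H, +oo[%classic = \bigcap_m F m.
  apply/seteqP; split=> x /=.
    rewrite in_itv/= andbT => Hx m _; rewrite /F/= in_itv/= andbT.
    by rewrite (lt_le_trans _ Hx)// ltrBlDr ltrDl invr_gt0.
  move=> Fx; rewrite in_itv/= andbT; apply/ler_addgt0Pr => e e0.
  have [m _ me] := near_infty_natSinv_lt (PosNum e0).
  have := Fx m Logic.I; rewrite /F/= in_itv/= andbT ltrBlDr => /ltW Hm.
  by rewrite (le_trans Hm)// lerD2l ltW// me/=.
have Fcvg : (nu \o F) x @[x --> \oo] --> nu (\bigcap_m F m).
  apply: nonincreasing_cvg_mu.
  - have := fin_num_measure nu (F 0%N) (measurable_itv _).
    by rewrite fin_numElt => /andP[].
  - by move=> m; exact: measurable_itv.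
  - by apply: bigcapT_measurable => m; exact: measurable_itv.
  - move=> a b ab; rewrite subsetEset => x; rewrite /F/= !in_itv/= !andbT.
    by apply: le_lt_trans; rewrite lerB// lef_pV2 ?posrE// ler_nat.
rewrite -(cvg_lim _ Fcvg)//; apply: lime_ge; first by apply/cvg_ex; eexists; exact: Fcvg.
near=> m; have [|x [x0 zx] Hx] := sup_adherent _ hs (eps := m.+1%:R^-1).
  by rewrite invr_gt0.
apply: (le_trans zx); rewrite /ccdf_of /=; apply: le_measure; rewrite ?inE.
- exact: measurable_itv.
- exact: measurable_itv.
- move=> y; rewrite /F/= !in_itv/= !andbT; exact: lt_trans.
Unshelve. all: by end_near. Qed.

End InverseCcdf.

(** * Locations and weights *)

Section CellProbability.
Context {R : realType}.
Variables (rho : R) (rho_gt0 : 0 < rho).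

Definition cell (k : nat) : set (R * R) :=
  `[k%:R * rho, k%:R * rho + rho / 2]%classic `*` `[0, rho / 2]%classic.

Lemma cellE k (x : R * R) : cell k x <-> incell rho k x.
Proof.
rewrite /cell /= !in_itv/= /incell; split.
  by move=> [/andP[-> ->] /andP[-> ->]].
by move=> /and4P[-> -> -> ->].
Qed.

Lemma measurable_cell k : measurable (cell k).
Proof. by apply: measurableX; exact: measurable_itv. Qed.

Lemma cell_unit_square k : k.+1%:R * rho <= 2^-1 -> rho <= 2^-1 ->
  cell k `<=` unit_square.
Proof.
move=> kr r1 x /cellE/and4P[x1 x2 x3 x4]; rewrite /unit_square/= !in_itv/=.
move: kr; rewrite -natr1 mulrDl mul1r => kr.
have k0 : 0 <= k%:R * rho by rewrite mulr_ge0// ltW.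
have := rho_gt0; split; apply/andP; split; lra.
Qed.

Lemma cell_mass (f : R * R -> R) (eps1 : R) k : 0 < eps1 ->
  measurable_fun unit_square f -> (forall x, unit_square x -> eps1 <= f x) ->
  cell k `<=` unit_square ->
  ((eps1 * (rho / 2) ^+ 2)%:E <=
   \int[lebesgue_measure \x lebesgue_measure]_(x in cell k `&` unit_square) (f x)%:E)%E.
Proof.
move=> e0 mf fe cS; rewrite (setIidl cS).
have mc := measurable_cell k.
have r20 : 0 < rho / 2 by rewrite divr_gt0.
have itvE a b : a < b -> lebesgue_measure `[a, b]%classic = (b - a)%:E :> \bar R.
  by move=> ab; rewrite lebesgue_measure_itv/= lte_fin ab -EFinD.
have -> : (eps1 * (rho / 2) ^+ 2)%:E =
   (\int[lebesgue_measure \x lebesgue_measure]_(x in cell k) (eps1)%:E)%E.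
  rewrite integral_cst//= /cell product_measure1E; try exact: measurable_itv.
  transitivity (eps1%:E * ((rho / 2)%:E * (rho / 2)%:E))%E.
    by rewrite -!EFinM expr2.
  congr (_ * (_ * _))%E; apply/esym.
    by apply: (etrans (itvE _ _ _)); rewrite ?ltrDl// addrC addKr.
  by apply: (etrans (itvE _ _ _)); rewrite ?subr0.
apply: ge0_le_integral => //.
- by move=> x _; rewrite lee_fin ltW.
- apply/measurable_realfun.measurable_EFinP; apply: measurable_funS mf => //.
  by apply: measurableX; exact: measurable_itv.
- by move=> x /cS/fe; rewrite lee_fin.
Qed.

End CellProbability.

Section Model.
Context {d : measure_display} {T : measurableType d} {R : realType}.
Variables (P : probability T R) (n : nat).

Lemma preimage_sigma d' (T' : measurableType d') (Y : T -> T') (B : set T') :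
  measurable B -> g_sigma_algebra_preimage Y (Y @^-1` B).
Proof. by move=> mB; exists B => //; rewrite setTI. Qed.

Section Locations.
Variables (X : 'I_n -> {RV P >-> (R * R)%type}) (rho : R) (k : nat).
Hypothesis X_indep : mutually_independent P [set: 'I_n]%SET
  (fun i => g_sigma_algebra_preimage (X i)).

Lemma incell_preimage i : [set t | incell rho k (X i t)] = X i @^-1` cell rho k.
Proof. by apply/seteqP; split=> t /=; rewrite cellE. Qed.

Lemma measurable_incell i : measurable [set t | incell rho k (X i t)].
Proof.
rewrite incell_preimage -[_ @^-1` _]setTI.
by apply: measurable_funPT => //; exact: measurable_cell.
Qed.

Lemma few_in_cell_bound (a : R) (m : nat) :
  (forall i, a <= pr P [set t | incell rho k (X i t)]) ->
  pr P [set t | (#|[set i | incell rho k (X i t)]%SET| < m)%N] <=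
  2 ^+ m * expR (- (n%:R * a / 2)).
Proof.
move=> aX; have := @chernoff_lower _ T R P 'I_n (fun i t => incell rho k (X i t))
  (measurable_incell) a m; rewrite card_ord; apply => // S.
set E := fun i => if i \in S then _ else _.
have mE i : measurable (E i).
  by rewrite /E; case: ifP => _; [|apply: measurableC]; exact: measurable_incell.
have Esig i : g_sigma_algebra_preimage (X i) (E i).
  rewrite /E incell_preimage; case: ifP => _.
    by apply: preimage_sigma; exact: measurable_cell.
  rewrite preimage_setC; apply: preimage_sigma.
  by apply: measurableC; exact: measurable_cell.
have := @X_indep [set: 'I_n]%SET E (fintype.subxx _) (fun i _ => Esig i).
rewrite (_ : [set i | i \in [set: 'I_n]%SET] = setT); last first.
  by apply/seteqP; split=> // i _; rewrite /= finset.in_setT.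
move=> indep; apply: EFin_inj; rewrite -prE; last first.
  by apply: fin_bigcap_measurable => // i _; exact: mE.
rewrite indep -prodEFin; apply: eq_big => [i|i _]; first by rewrite finset.in_setT.
rewrite (prE P (mE i)) /E; case: ifP => // _; rewrite pr_setC//.
exact: measurable_incell.
Qed.

End Locations.

Section Weights.
Variables (W : {set vertex n} -> {RV P >-> R}) (nu : probability R R).
Hypothesis W_law : forall e, e \in K2_edges n -> forall A : set R, measurable A ->
  distribution P (W e) A = nu A.
Hypothesis W_indep : mutually_independent P (K2_edges n)
  (fun e => g_sigma_algebra_preimage (W e)).

(** The law of [W e] is prescribed on [K2_edges] only. Excluding the other pairs makes these events
    measurable for the sigma-algebra generated by the weights of the edges. *)
Definition heavy_edge (w : R) (e : {set vertex n}) (t : T) : bool :=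
  (e \in K2_edges n) && (w <= W e t).

Lemma measurable_heavy_edge w e : measurable [set t | heavy_edge w e t].
Proof.
rewrite /heavy_edge; case: (e \in K2_edges n) => /=; last first.
  by rewrite (_ : mkset _ = set0)//; apply/seteqP; split.
rewrite (_ : mkset _ = setT `&` W e @^-1` `[w, +oo[%classic).
  by apply: measurable_funPT => //; exact: measurable_itv.
by rewrite setTI; apply/seteqP; split=> t /=; rewrite in_itv/= andbT.
Qed.

Lemma no_heavy_edge_bound (w p : R) :
  (p%:E <= nu `[w, +oo[%classic)%E ->
  forall Q : {set {set vertex n}}, Q \subset K2_edges n ->
  pr P [set t | [forall e in Q, ~~ heavy_edge w e t]] <= expR (- (p * #|Q|%:R)).
Proof.
move=> pw Q /fintype.subsetP QK.
pose A e := W e @^-1` `]-oo, w[%classic.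
have mA e : measurable (A e).
  rewrite /A -[_ @^-1` _]setTI.
  by apply: measurable_funPT => //; exact: measurable_itv.
have -> : [set t | [forall e in Q, ~~ heavy_edge w e t]] =
    \bigcap_(e in [set e | e \in Q]) A e.
  apply/seteqP; split=> t /=.
    move=> /forall_inP H e /= eQ; have := H e eQ.
    by rewrite /heavy_edge QK//= -ltNge /A/= in_itv.
  move=> H; apply/forall_inP => e eQ; have := H e eQ.
  by rewrite /A/= in_itv/= /heavy_edge QK//= -ltNge.
have := @W_indep Q A _ (fun e _ => preimage_sigma _ (measurable_itv _)).
move=> /(_ (introT fintype.subsetP QK)) indep.
have prA e : e \in Q -> pr P (A e) <= expR (- p).
  move=> eQ; have := W_law (QK e eQ) (measurable_itv `]-oo, w[).
  rewrite /distribution/= /pushforward/= -/(A e) (prE P (mA e)) => prAE.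
  apply: le_trans (expR_ge1Dx _); rewrite -lee_fin prAE.
  rewrite (_ : `]-oo, w[%classic = ~` `[w, +oo[%classic); last first.
    by rewrite setCitvr.
  rewrite probability_setC; last exact: measurable_itv.
  rewrite (prE nu (measurable_itv _)) in pw *.
  by rewrite -EFinB lee_fin; rewrite lee_fin in pw; lra.
rewrite -lee_fin -prE; last by apply: fin_bigcap_measurable => // e _; exact: mA.
rewrite indep.
have -> : (\prod_(e in Q) P (A e) = (\prod_(e in Q) pr P (A e))%:E)%E.
  by rewrite -prodEFin; apply: eq_bigr => e _; exact: prE.
rewrite lee_fin.
apply: (@le_trans _ _ (\prod_(e in Q) expR (- p))).
  by apply: ler_prod => e eQ; rewrite prA// pr_ge0.
by rewrite prodr_const -expRM_natl ler_expR; lra.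
Qed.

End Weights.
End Model.

(** * Measurability of the maximal weight *)

Section MeasurableMaxWeight.
Context {d : measure_display} {T : measurableType d} {R : realType}.
Variables (P : probability T R) (n : nat).
Variables (X : 'I_n -> {RV P >-> (R * R)%type}) (W : {set vertex n} -> {RV P >-> R}).
Variables (zeta r q w theta : R).

Let loc (t : T) := location zeta (fun i => X i t).

Lemma measurable_location u :
  measurable_fun setT (fun t => (loc t u).1) /\ measurable_fun setT (fun t => (loc t u).2).
Proof.
case: u => [i|[]]; rewrite /loc /=; last 2 first.
- by split; exact: measurable_cst.
- by split; exact: measurable_cst.
have mX : measurable_fun setT (X i) by exact: measurable_funPT.
by split; [exact: (measurableT_comp measurable_fst mX)|
  exact: (measurableT_comp measurable_snd mX)].
Qed.

Lemma measurable_dist u v :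
  measurable_fun setT (fun t => euclid_dist (loc t u) (loc t v)).
Proof.
have [u1 u2] := measurable_location u; have [v1 v2] := measurable_location v.
pose g t := ((loc t u).1 - (loc t v).1) ^+ 2 + ((loc t u).2 - (loc t v).2) ^+ 2.
have mg : measurable_fun setT g.
  by apply: measurable_realfun.measurable_funD; apply: measurable_realfun.measurable_funX;
    exact: measurable_realfun.measurable_funB.
have ms : measurable_fun setT (Num.sqrt : R -> R).
  by apply: measurable_realfun.continuous_measurable_fun; exact: sqrt_continuous.
exact: (measurableT_comp ms mg).
Qed.

Lemma measurable_ge (g : T -> R) (x : R) : measurable_fun setT g ->
  measurable [set t | x <= g t].
Proof.
move=> mg; rewrite (_ : mkset _ = setT `&` g @^-1` `[x, +oo[%classic).
  by apply: mg => //; exact: measurable_itv.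
by rewrite setTI; apply/seteqP; split=> t /=; rewrite in_itv/= andbT.
Qed.

Lemma measurable_lt (g : T -> R) (x : R) : measurable_fun setT g ->
  measurable [set t | g t < x].
Proof.
move=> mg; rewrite (_ : mkset _ = setT `&` g @^-1` `]-oo, x[%classic).
  by apply: mg => //; exact: measurable_itv.
by rewrite setTI; apply/seteqP; split=> t /=; rewrite in_itv/=.
Qed.

Lemma measurable_andb (a b : T -> bool) : measurable [set t | a t] ->
  measurable [set t | b t] -> measurable [set t | a t && b t].
Proof.
move=> ma mb; rewrite (_ : mkset _ = [set t | a t] `&` [set t | b t]).
  exact: measurableI.
by apply/seteqP; split=> t /=; [move/andP|move=> [-> ->]].
Qed.

Lemma measurable_bool (a : bool) : measurable [set t : T | a].
Proof.
case: a; first by rewrite (_ : mkset _ = setT)//; apply/seteqP; split.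
by rewrite (_ : mkset _ = set0)//; apply/seteqP; split.
Qed.

Lemma measurable_path (e : T -> rel (vertex n)) x p :
  (forall u v, measurable [set t | e t u v]) ->
  measurable [set t | path (e t) x p].
Proof.
move=> me; elim: p x => [|y p IH] x /=; first exact: measurable_bool.
exact: measurable_andb.
Qed.

Lemma measurable_lqw_path p :
  measurable [set t | lqw_path r (loc t) (fun e => W e t) theta q w p].
Proof.
rewrite /lqw_path /rgg_path; apply: measurable_andb.
- apply: measurable_andb; first exact: measurable_bool.
  apply: measurable_andb; first exact: measurable_bool.
  apply: measurable_path => u v; apply: measurable_andb; first exact: measurable_bool.
  exact/measurable_lt/measurable_dist.
- apply: measurable_andb; first exact: measurable_bool.
  apply: measurable_path => u v; apply: measurable_andb.
    exact/measurable_ge/measurable_dist.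
  exact/measurable_ge/measurable_funPT.
Qed.

Lemma measurable_max_weight (x : R) : 0 < x ->
  measurable [set t | x <= max_weight r (loc t) (fun e => W e t) theta q w].
Proof.
move=> x0.
(* As [x] is positive, the value 0 for the absence of paths is excluded. A path has distinct
   vertices, hence bounded length, and the union is over a finite type. *)
have -> : [set t | x <= max_weight r (loc t) (fun e => W e t) theta q w] =
  \bigcup_(b in [set: (#|vertex n|).-bseq (vertex n)])
    ([set t | lqw_path r (loc t) (fun e => W e t) theta q w b] `&`
     [set t | x <= path_weight (fun e => W e t) b]).
  apply/seteqP; split=> t /=.
    have [ex|noex] := pselect (exists p, lqw_path r (loc t) (fun e => W e t) theta q w p).
      have [p pp [-> _]] := max_weightP ex => xp.
      have sz : (size p <= #|vertex n|)%N.
        move: pp => /and3P[/and3P[+ _ _] _ _] => /card_uniqP Ep.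
        by apply: (leq_trans (leqnSn _)); rewrite -[(size p).+1]Ep max_card.
      by exists (Bseq sz).
    rewrite max_weight0; first by rewrite leNgt x0.
    by move=> p; apply/negP => pp; apply: noex; exists p.
  move=> [b _ [pb xb]].
  have [p _ [-> pmax]] := max_weightP (ex_intro _ (val b) pb).
  exact: le_trans (pmax _ pb).
apply: fin_bigcup_measurable => // b _; apply: measurableI.
  exact: measurable_lqw_path.
apply: measurable_ge; apply: measurable_sum => e.
exact: measurable_funPT.
Qed.

End MeasurableMaxWeight.

(** * The estimate for fixed parameters *)

Section FixedSize.
Context {d : measure_display} {T : measurableType d} {R : realType}.
Variables (P : probability T R) (n : nat).
Variables (X : 'I_n -> {RV P >-> (R * R)%type}) (W : {set vertex n} -> {RV P >-> R})
  (nu : probability R R).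
Hypothesis X_indep : mutually_independent P [set: 'I_n]%SET
  (fun i => g_sigma_algebra_preimage (X i)).
Hypothesis W_law : forall e, e \in K2_edges n -> forall A : set R, measurable A ->
  distribution P (W e) A = nu A.
Hypothesis W_indep : mutually_independent P (K2_edges n)
  (fun e => g_sigma_algebra_preimage (W e)).
Hypothesis XW_indep : independent_classes P
  (sigma_of_family [set: 'I_n]%SET (fun i => X i : T -> R * R))
  (sigma_of_family (K2_edges n) (fun e => W e : T -> R)).

Variables (K J M h : nat) (s : nat -> nat).
Let period := K.*2.+2.
Let l := (J * period + K.*2.+1)%N.
Variables (rho r zeta q w alpha : R).
Hypotheses (K_gt0 : (0 < K)%N) (s0 : s 0 = 1%N) (sM : (s K <= M)%N).
Hypotheses (rho_gt0 : 0 < rho) (rho_r : 2 * rho < r) (q_rho : q <= rho / 2)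
  (zetaE : zeta = l%:R * rho).
Hypotheses (w_ge0 : 0 <= w) (w_alpha : w <= alpha).

Lemma l_gt1 : (1 < l)%N.
Proof. by rewrite /l; lia. Qed.

Let start (j : nat) := (j * period + K.*2.+1)%N.

Lemma start_lt j : (j < J)%N -> (start j).+1 = (j.+1 * period)%N /\
  ((start j).+1 < l)%N.
Proof.
move=> jJ; have : (j.+1 * period <= J * period)%N by rewrite leq_mul2r jJ orbT.
by rewrite /start /l mulSn /period; lia.
Qed.

Let Z (t : T) := cell_pattern l rho (fun i => X i t).

Definition heavy_stage (Z : {set 'I_n * 'I_l.+1}) (j : 'I_J) (t : T) : bool :=
  [exists e in cross (layer Z (start j)) (layer Z (start j).+1),
     heavy_edge W alpha e t].

Definition weights_good (Z : {set 'I_n * 'I_l.+1}) (t : T) : Prop :=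
  expander (layer Z) K l s (open_edges (heavy_edge W w) t) /\
  (h <= #|[set j | heavy_stage Z j t]%SET|)%N.

Definition layers_good (Z : {set 'I_n * 'I_l.+1}) : Prop :=
  single_cell Z /\ forall k, (0 < k < l)%N -> (M <= #|layer Z k|)%N.

Lemma good_max_weight (theta : R) (t : T) : l%:R <= theta ->
  layers_good (Z t) -> weights_good (Z t) t ->
  h%:R * alpha <= max_weight r (location zeta (fun i => X i t))
    (fun e => W e t) theta q w.
Proof.
move=> ltheta [Zsingle ZM] [[fw bw join] hH].
pose S := open_edges (heavy_edge W w) t.
have exab j : exists ab : vertex n * vertex n, (j < J)%N ->
    [/\ ab.1 \in layer (Z t) (start j), ab.2 \in layer (Z t) (start j).+1,
      set_adj S ab.1 ab.2 &
      forall jJ : (j < J)%N, heavy_stage (Z t) (Ordinal jJ) t ->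
        heavy_edge W alpha [set ab.1; ab.2]%SET t].
  have /orP[jJ|Jj] : (j < J)%N || (J <= j)%N by case: ltnP.
    2: by exists (O1, O1) => jJ; lia.
  have [_ sl] := start_lt jJ.
  have [/exists_inP[e /imset2P[a b aD bD ->] heavy]|nheavy] :=
      boolP (heavy_stage (Z t) (Ordinal jJ) t).
    exists (a, b) => _ /=; split=> //.
    move: heavy => /andP[eK ew]; rewrite /set_adj inE; apply/andP; split => //.
    exact: le_trans w_alpha ew.
  (* A stage without heavy edge still needs an edge of weight at least [w]; joining provides one,
     since both layers contain [s K] vertices. *)
  have sl' : (0 < start j < l)%N by rewrite (ltnW sl) andbT /start addnS.
  have [A AD As] := exists_subset_card (leq_trans sM (ZM (start j) sl')).
  have [B BD Bs] := exists_subset_card (leq_trans sM (ZM (start j).+1 sl)).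
  have [a [b [aA bB ab]]] := join (start j) (proj1 (andP sl')) sl A B AD BD As Bs.
  exists (a, b) => _; split => //=.
  - exact: (fintype.subsetP AD).
  - exact: (fintype.subsetP BD).
  - move=> jJ' hv; case/negP: nheavy; rewrite (_ : Ordinal jJ = Ordinal jJ')//.
    exact: val_inj.
have [ab abP] := choice exab.
have [||||||| x [xc x0 xl xab]] := @chain_through _ (set_adj S) (layer (Z t)) K s s0 J O1 O2
  (fun j => (ab j).1) (fun j => (ab j).2).
- by rewrite O1_layer// l_gt1.
- by rewrite O2_layer// l_gt1.
- exact: fw.
- exact: bw.
- exact: join.
- exact: K_gt0.
- move=> j jJ; have [a1 b1 ab1 _] := abP j jJ.
  by have [<- _] := start_lt jJ.
apply: (@le_trans _ _ (\sum_(j < l) W [set x j; x j.+1]%SET t)); last first.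
  apply: (@chain_max_weight R n l rho r zeta q w (fun i => X i t) (fun e => W e t)
    rho_gt0 rho_r q_rho zetaE l_gt1 S x) => //.
  by move=> e; rewrite inE => /andP[].
apply: (@le_trans _ _ (#|[set j | heavy_stage (Z t) j t]%SET|%:R * alpha)).
  by rewrite ler_wpM2r ?ler_nat// (le_trans w_ge0).
apply: (@sum_ge_heavy R l J (fun j => W [set x j; x j.+1]%SET t) start).
- move=> j jl; have := xc.2 j jl; rewrite /set_adj inE => /andP[_].
  exact: le_trans.
- by move=> i j /addIn/eqP; rewrite eqn_mul2r => /orP[//|/eqP].
- by move=> j jJ; have [_ /ltnW] := start_lt jJ.
- move=> [j jJ]; rewrite inE => hv; have [_ _ _ /(_ jJ hv)] := abP j jJ.
  have [xa xb] := xab j jJ; have [sE _] := start_lt jJ.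
  by rewrite -xa -xb /= -sE => /andP[].
Qed.

Variables (a p p' lambda delta : R).
Hypothesis delta_ge0 : 0 <= delta.
Hypothesis X_mass : forall i k, (0 < k < l)%N ->
  a <= pr P [set t | incell rho k (X i t)].
Hypotheses (p_ge0 : 0 <= p) (p'_ge0 : 0 <= p').
Hypotheses (w_tail : (p%:E <= nu `[w, +oo[%classic)%E)
  (alpha_tail : (p'%:E <= nu `[alpha, +oo[%classic)%E).
Hypothesis expand_rate : forall i, (i < K)%N ->
  #|vertex n|.+1%:R ^+ (s i + s i.+1) * expR (- (p * (s i * (M - s i.+1))%:R))
    <= expR (- lambda).
Hypothesis join_rate :
  #|vertex n|.+1%:R ^+ (s K + s K) * expR (- (p * (s K * s K)%:R)) <= expR (- lambda).
Hypothesis few_heavy : forall Y : 'I_J -> T -> bool,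
  (forall j, measurable [set t | Y j t]) ->
  (forall S : {set 'I_J}, pr P [set t | [forall j in S, ~~ Y j t]] <=
     expR (- (p' * (M * M)%:R)) ^+ #|S|) ->
  pr P [set t | (#|[set j | Y j t]%SET| < h)%N] <= delta.

Lemma locations_failure : pr P [set t | ~ layers_good (Z t)] <=
  l%:R * (2 ^+ M * expR (- (n%:R * a / 2))).
Proof.
pose Q (k : 'I_l) := (0 < k)%N.
pose F (k : 'I_l) := [set t | (#|[set i | incell rho k (X i t)]%SET| < M)%N].
apply: (@le_trans _ _ (\sum_(k | Q k) pr P (F k))).
  apply: union_bound.
  - apply: (@measurable_pattern _ T _ (fun (ik : 'I_n * 'I_l.+1) t =>
      incell rho ik.2 (X ik.1 t)) (fun S => ~ layers_good S)) => ik.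
    exact: measurable_incell.
  - move=> k _; apply: (@measurable_pattern _ T _ (fun i t => incell rho k (X i t))
      (fun S : {set 'I_n} => (#|S| < M)%N)) => i.
    exact: measurable_incell.
  - move=> t nZ; apply: contrapT => noF; apply: nZ; split.
      exact: cell_pattern_single.
    move=> k /andP[k0 kl]; rewrite leqNgt; apply/negP => kM; apply: noF.
    exists (Ordinal kl) => //; rewrite /F/=; apply: leq_ltn_trans kM.
    have inl_inj : injective (fun i : 'I_n => inl i : vertex n) by move=> i j [].
    rewrite -(card_imset _ inl_inj); apply/subset_leq_card/fintype.subsetP => v.
    move=> /imsetP[i]; rewrite inE => ik ->; rewrite inl_layer//.
    by rewrite -lt0n k0 (ltn_eqF kl)/= inE/= inordK// ltnS ltnW.
apply: (@le_trans _ _ (\sum_(k | Q k) 2 ^+ M * expR (- (n%:R * a / 2)))).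
  apply: ler_sum => k k0; apply: few_in_cell_bound => // i.
  by apply: X_mass; rewrite ltn_ord andbT.
rewrite sumr_const -[leLHS]mulr_natl ler_wpM2r ?mulr_ge0 ?exprn_ge0 ?expR_ge0//.
by rewrite ler_nat -[X in (_ <= X)%N](card_ord l) max_card.
Qed.

Lemma measurable_heavy_stage Z' j : measurable [set t | heavy_stage Z' j t].
Proof.
rewrite (_ : mkset _ = [set t | (fun S : {set {set vertex n}} =>
  [exists e in cross (layer Z' (start j)) (layer Z' (start j).+1), e \in S])
  [set e | heavy_edge W alpha e t]%SET]).
  apply: (@measurable_pattern _ T _ (heavy_edge W alpha) (fun S : {set {set vertex n}} =>
    [exists e in cross (layer Z' (start j)) (layer Z' (start j).+1), e \in S])) => e.
  exact: measurable_heavy_edge.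
by apply/seteqP; split=> t /= /exists_inP[e eC eh]; apply/exists_inP; exists e => //;
  move: eh; rewrite inE.
Qed.

Lemma weights_failure Z' : layers_good Z' -> pr P [set t | ~ weights_good Z' t] <=
  (l * K.*2.+1)%:R * expR (- lambda) + delta.
Proof.
move=> [Zsingle ZM].
have mE : measurable [set t | ~ expander (layer Z') K l s (open_edges (heavy_edge W w) t)].
  apply: (@measurable_open _ T _ (heavy_edge W w) _
    (fun S => ~ expander (layer Z') K l s S)) => e.
  exact: measurable_heavy_edge.
have mH : measurable [set t | (#|[set j | heavy_stage Z' j t]%SET| < h)%N].
  apply: (@measurable_pattern _ T _ (heavy_stage Z')
      (fun S : {set 'I_J} => (#|S| < h)%N)) => j.
  exact: measurable_heavy_stage.
have -> : [set t | ~ weights_good Z' t] =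
    [set t | ~ expander (layer Z') K l s (open_edges (heavy_edge W w) t)] `|`
    [set t | (#|[set j | heavy_stage Z' j t]%SET| < h)%N].
  apply/seteqP; split=> t /=.
    rewrite /weights_good => /not_andP[nE|/negP]; first by left.
    by rewrite -ltnNge => nH; right.
  by move=> [nE [//]|]; rewrite ltnNge => /negP nH [].
apply: le_trans (pr_setU_le P mE mH) _; apply: lerD.
  apply: (@expander_failure _ T R P _ (K2_edges n) _ _ p p_ge0 _ _ K l M) => //.
  - exact: measurable_heavy_edge.
  - exact: no_heavy_edge_bound w_tail.
  - exact: (layer_disj Zsingle l_gt1).
  - exact: (layer_edges Zsingle l_gt1).
apply: few_heavy; first exact: measurable_heavy_stage.
apply: (@no_edge_family_bound _ T R P _ (K2_edges n) _ p' p'_ge0 _ _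
  (fun j : 'I_J => layer Z' (start j)) (fun j : 'I_J => layer Z' (start j).+1)).
- exact: no_heavy_edge_bound alpha_tail.
- by move=> j; have [_ /ltnW] := start_lt (ltn_ord j); exact: (layer_disj Zsingle l_gt1).
- by move=> j; have [_ /ltnW] := start_lt (ltn_ord j); exact: (layer_edges Zsingle l_gt1).
- by move=> j; have [_ /ltnW sl] := start_lt (ltn_ord j); apply: ZM; rewrite sl andbT /start addnS.
- by move=> j; have [_ sl] := start_lt (ltn_ord j); apply: ZM; rewrite sl.
(* Two stages sharing an edge coincide: if the edge is met in the same direction, the layers agree;
   in opposite directions one would have both [start i = (start j).+1] and
   [start j = (start i).+1]. *)
- move=> i j e /imset2P[u v ui vi ->] /imset2P[u' v' uj vj] /setP uv.
  have [_ il] := start_lt (ltn_ord i); have [_ jl] := start_lt (ltn_ord j).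
  have inj := @layer_inj n l Z' Zsingle l_gt1.
  have il1 := ltnW (ltnW il); have jl1 := ltnW (ltnW jl).
  have startI : start i = start j -> i = j.
    move=> /addIn/eqP; rewrite eqn_mul2r => /orP[//|/eqP]; exact: val_inj.
  have := uv u; rewrite !finset.in_set2 eqxx/= => /esym/orP[/eqP uu|/eqP uv'].
    by rewrite -uu in uj; exact/startI/(inj u _ _ il1 jl1 ui uj).
  have := uv v; rewrite !finset.in_set2 eqxx orbT => /esym/orP[/eqP vu|/eqP vv]; last first.
    rewrite -vv in vj; apply/startI/succn_inj.
    exact: (inj v _ _ (ltnW il) (ltnW jl) vi vj).
  rewrite -vu in uj; rewrite -uv' in vj.
  have := inj u _ _ il1 (ltnW jl) ui vj.
  by have <- := inj v _ _ (ltnW il) jl1 vi uj; move=> /eqP; rewrite (ltn_eqF (leqnSn _)).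
Qed.

Lemma sigma_heavy_edge x e :
  sigma_of_family (K2_edges n) (fun e => W e : T -> R) [set t | heavy_edge W x e t].
Proof.
have [eK|eK] := boolP (e \in K2_edges n); last first.
  rewrite (_ : mkset _ = set0); first exact: sigma_algebra0.
  by apply/seteqP; split=> t //=; rewrite /heavy_edge (negbTE eK).
apply: sub_sigma_algebra; exists e => //=.
rewrite (_ : mkset _ = W e @^-1` `[x, +oo[%classic).
  by apply: preimage_sigma; exact: measurable_itv.
by apply/seteqP; split=> t /=; rewrite /heavy_edge eK/= in_itv/= andbT.
Qed.

Lemma sigma_incell i k :
  sigma_of_family [set: 'I_n]%SET (fun i => X i : T -> R * R)
    [set t | incell rho k (X i t)].
Proof.
apply: sub_sigma_algebra; exists i => //=; rewrite ?finset.in_setT// incell_preimage.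
by apply: preimage_sigma; exact: measurable_cell.
Qed.

(** The failure is split according to the value [Z'] of the cell pattern. For a fixed good [Z'] the
    event on the weights is independent of [Z t = Z'], so its bound holds conditionally, and the
    probabilities of the patterns sum to 1. *)
Lemma max_weight_bound (theta x : R) : l%:R <= theta -> 0 < x -> x <= h%:R * alpha ->
  ((1 - (l%:R * (2 ^+ M * expR (- (n%:R * a / 2))) +
     ((l * K.*2.+1)%:R * expR (- lambda) + delta)))%:E <=
  P [set t | (x <= max_weight r (location zeta (fun i => X i t))
    (fun e => W e t) theta q w)%R])%E.
Proof.
move=> ltheta x0 xh.
set E := [set t | x <= _].
have mE : measurable E by exact: measurable_max_weight.
rewrite (prE P mE) lee_fin; set d2 := (_ + delta).
suff : pr P (~` E) <= l%:R * (2 ^+ M * expR (- (n%:R * a / 2))) + d2.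
  by rewrite pr_setC// lerBlDr -lerBlDl.
have mLG : measurable [set t | ~ layers_good (Z t)].
  apply: (@measurable_pattern _ T _ (fun (ik : 'I_n * 'I_l.+1) t =>
      incell rho ik.2 (X ik.1 t)) (fun S => ~ layers_good S)) => ik.
  exact: measurable_incell.
pose F (Z' : {set 'I_n * 'I_l.+1}) := [set t | Z t = Z'] `&` [set t | ~ weights_good Z' t].
(* Independence is given for the sigma-algebras generated by the locations and by the weights, so
   the two events are placed in them by reading [measurable_pattern] on [T] with the generated
   sigma-algebra. *)
have mZ Z' : sigma_of_family [set: 'I_n]%SET (fun i => X i : T -> R * R) [set t | Z t = Z'].
  exact: (@measurable_pattern _ (g_sigma_algebraType _) _ (fun (ik : 'I_n * 'I_l.+1) t =>
      incell rho ik.2 (X ik.1 t)) (fun S => S = Z') (fun ik => sigma_incell _ _)).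
have mW Z' : sigma_of_family (K2_edges n) (fun e => W e : T -> R)
    [set t | ~ weights_good Z' t].
  pose T' := g_sigma_algebraType (\bigcup_(e in [set e | e \in K2_edges n])
    g_sigma_algebra_preimage (W e : T -> R)).
  have hit j t : heavy_stage Z' j t = [exists e in cross (layer Z' (start j))
      (layer Z' (start j).+1), e \in open_edges (heavy_edge W alpha) t].
    by apply: eq_existsb => e; rewrite inE.
  have hitS t : [set j | heavy_stage Z' j t]%SET = [set j : 'I_J | [exists e in
      cross (layer Z' (start j)) (layer Z' (start j).+1),
      e \in open_edges (heavy_edge W alpha) t]]%SET.
    by apply/setP => j; rewrite !inE hit.
  rewrite /weights_good (_ : mkset _ = ~` ([set t : T' | expander (layer Z') K l s
      (open_edges (heavy_edge W w) t)] `&`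
    [set t : T' | (fun S : {set {set vertex n}} => (h <= #|[set j : 'I_J | [exists e in
      cross (layer Z' (start j)) (layer Z' (start j).+1),
      e \in S]]%SET|)%N) (open_edges (heavy_edge W alpha) t)])); last first.
    by apply/seteqP; split=> t /=; rewrite hitS.
  apply: (@measurableC _ T'); apply: measurableI.
    exact: (@measurable_pattern _ T' _ (heavy_edge W w)
      (fun S => expander (layer Z') K l s S) (sigma_heavy_edge w)).
  exact: (@measurable_pattern _ T' _ (heavy_edge W alpha)
    (fun S : {set {set vertex n}} => (h <= #|[set j : 'I_J | [exists e in
      cross (layer Z' (start j)) (layer Z' (start j).+1),
      e \in S]]%SET|)%N) (sigma_heavy_edge alpha)).
have mZT Z' : measurable [set t | Z t = Z'].
  apply: (@measurable_pattern_eq _ T _ (fun (ik : 'I_n * 'I_l.+1) t =>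
      incell rho ik.2 (X ik.1 t))) => ik.
  exact: measurable_incell.
have mWT Z' : measurable [set t | ~ weights_good Z' t].
  move: (mW Z'); apply: smallest_sub; first exact: sigma_algebra_measurable.
  move=> A [e _ [B mB <-]].
  by apply: measurable_funPT.
have indep Z' : pr P (F Z') = pr P [set t | Z t = Z'] * pr P [set t | ~ weights_good Z' t].
  apply: EFin_inj; rewrite EFinM -!prE//; last exact: measurableI.
  exact: XW_indep.
pose G := [set t | layers_good (Z t) /\ ~ weights_good (Z t) t].
have GE : G = \bigcup_(Z' in [set Z' | layers_good Z']) F Z'.
  apply/seteqP; split=> t /=; first by move=> [ZG nW]; exists (Z t).
  by move=> [Z' ZG [/= ZE nW]]; rewrite /G/= ZE.
have mG : measurable G.
  by rewrite GE; apply: fin_bigcup_measurable => // Z' _; exact: measurableI.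
have d2_ge0 : 0 <= d2 by rewrite addr_ge0// mulr_ge0// expR_ge0.
have GE2 : pr P G <= d2.
  apply: (@le_trans _ _ (\sum_(Z' | `[< layers_good Z' >]) pr P (F Z'))).
    apply: union_bound => //.
    - by move=> Z' _; exact: measurableI.
    - by move=> t [gZ nW]; exists (Z t) => //; apply/asboolP.
  apply: (@le_trans _ _ (\sum_(Z' : {set 'I_n * 'I_l.+1}) pr P [set t | Z t = Z'] * d2)).
    rewrite [leRHS](bigID (fun Z' => `[< layers_good Z' >]))/= ler_wpDr//.
      by apply: sumr_ge0 => Z' _; rewrite mulr_ge0 ?pr_ge0.
    apply: ler_sum => Z' /asboolP gZ; rewrite indep ler_wpM2l ?pr_ge0//.
    exact: weights_failure.
  rewrite -mulr_suml (@sum_pr_pattern _ T R P _ (fun (ik : 'I_n * 'I_l.+1) t =>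
      incell rho ik.2 (X ik.1 t))) ?mul1r// => ik.
  exact: measurable_incell.
apply: (@le_trans _ _ (pr P ([set t | ~ layers_good (Z t)] `|` G))).
  apply: le_pr; [exact: measurableC|exact: measurableU|].
  move=> t /= nE; have [gZ|] := pselect (layers_good (Z t)); last by left.
  right; split=> // gW; apply: nE; rewrite /E/=; apply: le_trans xh _.
  exact: good_max_weight.
apply: le_trans (pr_setU_le P mLG mG) _; apply: lerD => //.
exact: locations_failure.
Qed.

End FixedSize.

(** * Choice of parameters *)

Section Numerics.
Context {R : realType}.
Implicit Types (x y b C : R).

Lemma near_powR_ge b C : 0 < b -> \forall n \near \oo, C <= n%:R `^ b.
Proof.
move=> b0; near=> n.
pose C' := Num.max C 1.
have C'1 : 0 < C' by rewrite lt_max ltr01 orbT.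
apply: (@le_trans _ _ C'); first by rewrite le_max lexx.
have -> : C' = (C' `^ b^-1) `^ b by rewrite -powRrM mulVf ?gt_eqF// powRr1// ltW.
apply: ge0_ler_powR; rewrite ?nnegrE ?powR_ge0 ?(ltW b0)//.
near: n; exact: nbhs_infty_ger.
Unshelve. all: by end_near. Qed.

Lemma near_ln_powR b C : 0 < b -> \forall n \near \oo, C * ln n%:R <= n%:R `^ b.
Proof.
move=> b0; near=> n.
have n1 : (1 <= n)%N by near: n; exact: nbhs_infty_ge.
have n1R : 1 <= n%:R :> R by rewrite ler1n.
have n0 : 0 < n%:R :> R by rewrite ltr0n.
have b20 : 0 < b / 2 by rewrite divr_gt0.
have C2 : `|C| * (2 / b) <= n%:R `^ (b / 2) by near: n; apply: near_powR_ge; rewrite divr_gt0.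
have l1 : b / 2 * ln n%:R <= n%:R `^ (b / 2).
  rewrite -ln_powR; apply: ltW; apply: lt_le_trans (ln_sublinear _) _ => //.
  exact: powR_gt0.
(* One half of the power absorbs the constant, the other the logarithm. *)
have -> : n%:R `^ b = n%:R `^ (b / 2) * n%:R `^ (b / 2) :> R.
  by rewrite -powRD; [congr (_ `^ _); lra|apply/implyP => _; rewrite gt_eqF].
have ln0' : 0 <= ln n%:R :> R by exact: ln_ge0.
have -> : C * ln n%:R = (C * (2 / b)) * (b / 2 * ln n%:R).
  by field; rewrite gt_eqF.
apply: (@le_trans _ _ ((`|C| * (2 / b)) * (b / 2 * ln n%:R))).
  rewrite ler_wpM2r//; first by rewrite mulr_ge0// ltW.
  by rewrite ler_wpM2r ?ler_norm// divr_ge0// ltW.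
apply: ler_pM => //; first by rewrite mulr_ge0// divr_ge0// ltW.
by rewrite mulr_ge0// ltW.
Unshelve. all: by end_near. Qed.

Lemma near_ln_ge C : \forall n \near \oo, C <= ln n%:R.
Proof.
near=> n; rewrite -[C]expRK ler_ln ?posrE ?expR_gt0//; last first.
  by rewrite ltr0n; near: n; exact: nbhs_infty_ge.
near: n; exact: nbhs_infty_ger.
Unshelve. all: by end_near. Qed.

Lemma near_powR_ln_ge b C : 0 < b -> \forall n \near \oo, C <= (ln n%:R) `^ b.
Proof.
move=> b0; near=> n; pose C' := Num.max C 1.
have C'1 : 0 < C' by rewrite lt_max ltr01 orbT.
apply: (@le_trans _ _ C'); first by rewrite le_max lexx.
have -> : C' = (C' `^ b^-1) `^ b by rewrite -powRrM mulVf ?gt_eqF// powRr1// ltW.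
have lnC : C' `^ b^-1 <= ln n%:R by near: n; exact: near_ln_ge.
apply: ge0_ler_powR; rewrite ?nnegrE ?powR_ge0 ?(ltW b0)//.
exact: (le_trans (powR_ge0 _ _) lnC).
Unshelve. all: by end_near. Qed.

Lemma truncn_ge_half x : 1 <= x -> x / 2 <= (Num.truncn x)%:R.
Proof.
move=> x1; have x0 : 0 <= x by lra.
have /andP[t1 t2] := truncn_itv x0.
have : (1 <= Num.truncn x)%N by rewrite truncn_ge_nat.
rewrite -(ler_nat R) => t3; move: t2; rewrite -natr1; lra.
Qed.

(* With [y = 2 / (1 - x)] the base [y^-1 + x] equals [(1 + x) / 2 < 1], and [B] is
   chosen such that [y] is at most the [B]-th power of its inverse. *)
Lemma few_good_rate x : 0 <= x -> x < 1 ->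
  exists B : nat, exists y c : R, [/\ (0 < B)%N, 1 <= y, 0 < c &
    forall J : nat, y ^+ (J %/ B.*2) * (y^-1 + x) ^+ J <= expR (- (c * J%:R))].
Proof.
move=> x0 x1; pose y := 2 / (1 - x); pose x' := (1 + x) / 2.
have y1 : 1 <= y by rewrite /y ler_pdivlMr; lra.
have y0 : 0 < y by lra.
have yx : y^-1 + x = x' by rewrite /y /x' invf_div; lra.
have x'0 : 0 < x' by rewrite /x'; lra.
pose c := - ln x'; have c0 : 0 < c by rewrite oppr_gt0 ln_lt0// /x'; lra.
have xE : x' = expR (- c) by rewrite /c opprK lnK.
have yE : y = expR (ln y) by rewrite lnK.
pose B := (Num.truncn (ln y / c)).+1.
have BE : ln y <= c * B%:R.
  have : ln y / c < B%:R.
    by have /andP[] := truncn_itv (divr_ge0 (ln_ge0 y1) (ltW c0)).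
  by rewrite ltr_pdivrMr// mulrC => /ltW.
(* The exponent [J %/ B.*2] is at most [J / (2B)], so the power of [y] is at most [expR (c * J / 2)]
   and uses up half of the decay. *)
exists B, y, (c / 2); split=> //; first exact: divr_gt0.
move=> J; rewrite yx xE yE -!expRM_natl -expRD ler_expR.
have hJ : (J %/ B.*2)%:R * B%:R <= J%:R / 2 :> R.
  rewrite ler_pdivlMr// -!natrM ler_nat.
  by have := leq_trunc_div J B.*2; rewrite -muln2; lia.
have h0 : 0 <= (J %/ B.*2)%:R :> R by [].
have := ler_wpM2l h0 BE; have := ler_wpM2l (ltW c0) hJ; nra.
Qed.

End Numerics.

Lemma card_vertex n : #|vertex n| = n.+2.
Proof. by rewrite card_sum card_ord card_bool addn2. Qed.

Lemma addn3_le_sqr n : (2 < n)%N -> (n.+3 <= n ^ 2)%N.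
Proof. by move=> n2; rewrite expnS expn1; nia. Qed.

(** * Growth factor, cell occupancy and the resulting failure rates *)

Section GrowthRates.
Context {R : realType}.
Variables (n K : nat) (N eps c0 G : R).
Hypotheses (n_gt2 : (2 < n)%N) (N_ge1 : 1 <= N) (eps_gt0 : 0 < eps) (eps_lt : eps < 2^-1)
  (K_ge : 2 / eps <= K%:R) (c0_gt0 : 0 < c0) (G_ge0 : 0 <= G).
Hypotheses (h1 : (6 + G) * (16 / c0) * ln n%:R <= N `^ (eps / 2))
  (h2 : (6 + G) * ln n%:R <= N `^ (eps / 2))
  (h3 : 2 ^+ K * (16 / c0) <= N `^ (eps / 2)) (h4 : 4 <= c0 * N).

(** The factor [g] of the overview: its [K]-th power is at least [N^(1-eps/2)], the size needed for
    joining, while [K >= 2/eps] keeps [g] at most [2 * N^(eps/2)]. *)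
Definition growth : nat := (Num.truncn (N `^ ((1 - eps / 2) / K%:R))).+1.
(** A cell will have expected occupancy at least [c0 * N]. The quarter leaves room for the factor
    [2^M] of the Chernoff bound: [expR (M - c0 * N / 2)] is then at most [expR (- (c0 * N / 4))]. *)
Definition occupancy : nat := Num.truncn (c0 * N / 4).

Let u := N `^ (1 - eps / 2).
Let Q := N `^ (eps / 2).
Let p := (N `^ (1 - eps))^-1.

Let N0 : 0 < N. Proof. by rewrite (lt_le_trans _ N_ge1). Qed.
Let K0 : 0 < K%:R :> R.
Proof. by rewrite (lt_le_trans _ K_ge)// divr_gt0. Qed.
Let u0 : 0 < u. Proof. exact: powR_gt0. Qed.
Let Q0 : 0 < Q. Proof. exact: powR_gt0. Qed.
Let p0 : 0 < p. Proof. by rewrite invr_gt0 powR_gt0. Qed.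
Let Q1 : 1 <= Q.
Proof. by rewrite -[leLHS](powRr0 N) ler_powR// divr_ge0// ltW. Qed.

Let NE : N = u * Q.
Proof.
rewrite /u /Q -powRD; first by rewrite subrK powRr1// ltW.
by apply/implyP => _; rewrite gt_eqF.
Qed.

Let puE : p * u = Q.
Proof.
rewrite /p /u /Q -powRN -powRD; first by congr (_ `^ _); lra.
by apply/implyP => _; rewrite gt_eqF.
Qed.

Lemma growth_exp : u <= growth%:R ^+ K <= 2 ^+ K * u.
Proof.
set e := (1 - eps / 2) / K%:R; have e0 : 0 <= e.
  by rewrite divr_ge0 ?ltW//; have := eps_lt; lra.
have E1 : 1 <= N `^ e by rewrite -[leLHS](powRr0 N) ler_powR.
have uE : u = (N `^ e) ^+ K.
  by rewrite -powR_mulrn ?powR_ge0// -powRrM /e divfK// gt_eqF.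
have /andP[g1 g2] := truncn_itv (le_trans ler01 E1).
rewrite uE -exprMn !lerXn2r ?nnegrE ?mulr_ge0 ?powR_ge0 ?(ltW g2)//.
by rewrite /growth -natr1 -/e; lra.
Qed.

Lemma growth_le : 1 + growth%:R <= 3 * Q :> R.
Proof.
set e := (1 - eps / 2) / K%:R; have e0 : 0 <= e.
  by rewrite divr_ge0 ?ltW//; have := eps_lt; lra.
have eQ : N `^ e <= Q.
  apply: ler_powR => //; rewrite /e ler_pdivrMr//.
  have := ler_wpM2l (ltW (divr_gt0 eps_gt0 (ltr0n _ 2))) K_ge.
  rewrite (_ : eps / 2 * (2 / eps) = 1); first by have := eps_gt0; lra.
  by field; rewrite gt_eqF.
have /andP[g1 g2] := truncn_itv (powR_ge0 N e).
by rewrite /growth -natr1 -/e; have := Q1; lra.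
Qed.

Lemma occupancy_ge : c0 * N / 8 <= occupancy%:R :> R.
Proof.
by apply: le_trans (truncn_ge_half _); have := h4; lra.
Qed.

Lemma growth_exp_le : 2 * growth%:R ^+ K <= occupancy%:R :> R.
Proof.
have /andP[_ gu] := growth_exp; apply: le_trans occupancy_ge.
have h : 2 ^+ K * 16 * u <= c0 * N.
  rewrite NE mulrCA mulrC ler_wpM2l ?(ltW u0)// [leRHS]mulrC -ler_pdivrMr//.
  by rewrite -mulrA; exact: h3.
have := gu; lra.
Qed.

Let lnn : 0 <= ln n%:R :> R.
Proof. by apply: ln_ge0; rewrite ler1n; exact: ltnW (ltnW n_gt2). Qed.

Lemma ln_card_vertex : ln (#|vertex n|.+1%:R) <= 2 * ln n%:R :> R.
Proof.
have n0 : 0 < n%:R :> R by rewrite ltr0n; exact: ltnW (ltnW n_gt2).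
rewrite card_vertex mulr_natl -lnXn// ler_ln ?posrE ?exprn_gt0//.
by rewrite -natrX ler_nat addn3_le_sqr.
Qed.

Lemma card_vertex_exp m : #|vertex n|.+1%:R ^+ m =
  expR (m%:R * ln #|vertex n|.+1%:R) :> R.
Proof. by rewrite expRM_natl lnK// posrE. Qed.

Lemma growth_fits : (growth ^ K <= occupancy)%N.
Proof.
rewrite -(ler_nat R) natrX; have := growth_exp_le.
have : 0 <= growth%:R ^+ K :> R by rewrite exprn_ge0.
lra.
Qed.

(** After division by [s = growth^i] the entropy is at most [6 Q log n]. Since [p N = Q^2] and at
    least [c0 N / 16] vertices remain available, the gain is at least [c0 Q^2 / 16]; the extra
    factor [Q] beats the logarithm by [h1]. *)
Lemma growth_expand_rate i : (i < K)%N ->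
  #|vertex n|.+1%:R ^+ (growth ^ i + growth ^ i.+1) *
    expR (- (p * (growth ^ i * (occupancy - growth ^ i.+1))%:R)) <=
  expR (- (G * ln n%:R)).
Proof.
move=> iK; rewrite card_vertex_exp -expRD ler_expR.
have giK : (growth ^ i.+1 <= growth ^ K)%N by rewrite leq_pexp2l.
have giM := leq_trans giK growth_fits.
rewrite natrM natrB// natrD expnS natrM.
set g : R := growth%:R; set s : R := (growth ^ i)%:R.
set D := occupancy%:R - g * s.
have s1 : 1 <= s by rewrite ler1n expn_gt0.
have DN : c0 * N / 16 <= D.
  have : g * s <= g ^+ K by rewrite -natrM -natrX ler_nat -expnS.
  by have := growth_exp_le; have := occupancy_ge; rewrite -/g /D; lra.
have pN : p * N = Q * Q by rewrite NE mulrA puE.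
have pD : c0 / 16 * (Q * Q) <= p * D.
  by rewrite -pN; have := ler_wpM2l (ltW p0) DN; lra.
have g3 : 1 + g <= 3 * Q := growth_le.
have g0 : 0 <= 1 + g by rewrite addr_ge0.
have lnv := ln_card_vertex; set v := ln _ in lnv *.
have v1 : (1 + g) * v <= 3 * Q * (2 * ln n%:R).
  apply: (@le_trans _ _ ((1 + g) * (2 * ln n%:R))); first exact: ler_wpM2l.
  by rewrite ler_wpM2r// mulr_ge0.
have GQ : G * ln n%:R <= G * ln n%:R * Q by rewrite ler_peMr// mulr_ge0.
have hQ : (6 + G) * ln n%:R * Q <= c0 / 16 * (Q * Q).
  rewrite mulrA ler_wpM2r ?(ltW Q0)//.
  have := ler_wpM2l (ltW (divr_gt0 c0_gt0 (ltr0n R 16))) h1; rewrite -/Q.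
  by congr (_ <= _); field; rewrite gt_eqF.
have key : (1 + g) * v + G * ln n%:R <= p * D by lra.
have Gs : G * ln n%:R <= s * (G * ln n%:R) by rewrite ler_peMl// mulr_ge0.
have := ler_wpM2l (le_trans ler01 s1) key; nra.
Qed.

(** After division by [s = growth^K] the gain is [p s], at least [p u = Q], which exceeds the
    logarithm by [h2]. *)
Lemma growth_join_rate :
  #|vertex n|.+1%:R ^+ (growth ^ K + growth ^ K) *
    expR (- (p * (growth ^ K * growth ^ K)%:R)) <= expR (- (G * ln n%:R)).
Proof.
rewrite card_vertex_exp -expRD ler_expR natrM natrD natrX.
set s : R := growth%:R ^+ K.
have /andP[us _] := growth_exp; rewrite -/s in us.
have s1 : 1 <= s by rewrite /s -natrX ler1n expn_gt0.
have psQ : Q <= p * s by rewrite -puE ler_wpM2l// ltW.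
have lnv := ln_card_vertex; set v := ln _ in lnv *.
have key : 2 * v + G * ln n%:R <= p * s by have := h2; rewrite -/Q; have := lnn; lra.
have Gs : G * ln n%:R <= s * (G * ln n%:R) by rewrite ler_peMl// mulr_ge0.
have := ler_wpM2l (le_trans ler01 s1) key; nra.
Qed.

End GrowthRates.

Lemma some_bad_bound d (T : measurableType d) (R : realType) (P : probability T R)
    (J : nat) (Y : 'I_J -> T -> bool) (x : R) :
  (forall j, measurable [set t | Y j t]) ->
  (forall S : {set 'I_J}, pr P [set t | [forall j in S, ~~ Y j t]] <= x ^+ #|S|) ->
  pr P [set t | (#|[set j | Y j t]%SET| < J)%N] <= J%:R * x.
Proof.
move=> mY xS; apply: (@le_trans _ _ (\sum_(j : 'I_J) x)); last first.
  by rewrite sumr_const card_ord mulr_natl.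
apply: (@le_trans _ _ (\sum_(j : 'I_J) pr P [set t | ~~ Y j t])).
  have mN j : measurable [set t | ~~ Y j t].
    rewrite (_ : mkset _ = ~` [set t | Y j t]); first exact: measurableC.
    by apply/seteqP; split=> t /negP.
  apply: union_bound => //.
    exact: (@measurable_pattern _ T _ Y (fun S : {set 'I_J} => (#|S| < J)%N)).
  move=> t /= tJ; apply: contrapT => allY; move: tJ; rewrite ltnNge => /negP[].
  rewrite (_ : [set j | Y j t]%SET = [set: 'I_J]%SET) ?cardsT ?card_ord//.
  apply/setP => j; rewrite !inE; apply/negPn/negP => nY.
  by apply: allY; exists j.
apply: ler_sum => j _; have := xS [set j]%SET; rewrite cards1 expr1.
apply: le_trans; rewrite le_eqVlt; apply/orP; left; apply/eqP; congr (pr P _).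
apply/seteqP; split=> t /= => [nY|/forall_inP/(_ j)]; last first.
  by apply; rewrite finset.set11.
by apply/forall_inP => i; rewrite finset.in_set1 => /eqP->.
Qed.

Lemma period_ge4 K : (0 < K)%N -> (4 <= K.*2.+2)%N.
Proof. by move=> K0; rewrite !ltnS (leq_double 1). Qed.

(** Rounding [J / (2B)] down costs at most a factor two; this is the origin of the constant
    [1 / (4B)] in [theta2]. *)
Lemma leq_div_double J B : (0 < B)%N -> (B.*2.*2 <= J)%N ->
  (J <= J %/ B.*2 * B.*2.*2)%N.
Proof.
move=> B0 JB; have B2 : (0 < B.*2)%N by rewrite double_gt0.
have := ltn_pmod J B2; have := divn_eq J B.*2.
by rewrite -[B.*2.*2]muln2 mulnA; lia.
Qed.

(** * The estimate for one [n], given the numerical inequalities valid for large [n] *)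

Section LargeSize.
Context {d : measure_display} {T : measurableType d} {R : realType}.
Variables (P : probability T R) (n : nat).
Variables (X : 'I_n -> {RV P >-> (R * R)%type}) (W : {set vertex n} -> {RV P >-> R})
  (nu : probability R R) (f : R * R -> R) (eps1 : R).
Hypotheses (eps1_gt0 : 0 < eps1) (f_meas : measurable_fun unit_square f)
  (f_ge : forall x, unit_square x -> eps1 <= f x).
Hypothesis X_law : forall (i : 'I_n) (A : set (R * R)), measurable A ->
  (distribution P (X i) A
   = \int[lebesgue_measure \x lebesgue_measure]_(x in A `&` unit_square) (f x)%:E)%E.
Hypothesis X_indep : mutually_independent P [set: 'I_n]%SET
  (fun i => g_sigma_algebra_preimage (X i)).
Hypothesis W_law : forall e, e \in K2_edges n -> forall A : set R, measurable A ->
  distribution P (W e) A = nu A.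
Hypothesis W_indep : mutually_independent P (K2_edges n)
  (fun e => g_sigma_algebra_preimage (W e)).
Hypothesis XW_indep : independent_classes P
  (sigma_of_family [set: 'I_n]%SET (fun i => X i : T -> R * R))
  (sigma_of_family (K2_edges n) (fun e => W e : T -> R)).

Variables (K B : nat) (r zeta q eps gamma kappa y c2 z0 : R).
Let A : R := K.*2.+2%:R.
(** The cells have side [rho / 2], at least [r / (6A)], so [c0 * r^2] bounds their mass from
    below. *)
Let c0 : R := eps1 / (36 * A ^+ 2).
(** Each elementary failure has probability at most [n^(-G)]; there are at most [n^2] of them, which
    leaves [n^(-(1 + gamma))]. *)
Let G : R := gamma + 3.
Let L := zeta / r.
Let N := n%:R * r ^+ 2.
Let logk := (ln n%:R) `^ (1 + kappa).
Let H := inv_ccdf nu.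

Hypotheses (r_gt0 : 0 < r) (zeta_gt0 : 0 < zeta) (zeta_lt : zeta < 2^-1)
  (L_ge1 : 1 <= L) (L_le : L <= n%:R) (q_le : q <= r / (6 * A)).
Hypotheses (eps_gt0 : 0 < eps) (eps_lt : eps < 2^-1) (gamma_gt0 : 0 < gamma)
  (K_ge : 2 / eps <= K%:R) (K_gt0 : (0 < K)%N).
Hypotheses (B_gt0 : (0 < B)%N) (y_ge1 : 1 <= y) (c2_gt0 : 0 < c2).
Hypothesis rate : forall J : nat,
  y ^+ (J %/ B.*2) * (y^-1 + expR (- (c0 ^+ 2 / 64))) ^+ J <= expR (- (c2 * J%:R)).
Hypothesis H_incr : forall z1 z2, z0 <= z1 -> z1 < z2 -> H z1 < H z2.
Hypotheses (n_gt2 : (2 < n)%N) (N_gt1 : 1 < N)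
  (h1 : (6 + G) * (16 / c0) * ln n%:R <= N `^ (eps / 2))
  (h2 : (6 + G) * ln n%:R <= N `^ (eps / 2))
  (h3 : 2 ^+ K * (16 / c0) <= N `^ (eps / 2)) (h4 : 4 <= c0 * N)
  (hN : G * ln n%:R <= c0 * N / 4)
  (hn : (3 * A) * K.*2.+3%:R <= n%:R)
  (hk1 : G * ln n%:R <= c0 ^+ 2 / 64 * logk)
  (hk2 : G * ln n%:R <= c2 * logk) (hk3 : B.*2.*2%:R <= logk)
  (hk4 : logk <= N) (logk_gt0 : 0 < logk) (hz : z0 < N `^ (1 - eps)).

Let J := (Num.truncn L).+1.
Let l := (J * K.*2.+2 + K.*2.+1)%N.
Let rho := zeta / l%:R.

Let A_ge4 : 4 <= A.
Proof. by rewrite /A (ler_nat R 4) period_ge4. Qed.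
Let A_gt0 : 0 < A. Proof. by have := A_ge4; lra. Qed.
Let c0_gt0 : 0 < c0.
Proof. by rewrite divr_gt0// mulr_gt0// exprn_gt0. Qed.
Let N_gt0 : 0 < N. Proof. by have := N_gt1; lra. Qed.
Let zetaE : zeta = L * r. Proof. by rewrite divfK// gt_eqF. Qed.
Let J_bounds : L < J%:R <= L + 1.
Proof.
have /andP[t1 t2] := truncn_itv (le_trans ler01 L_ge1).
by rewrite t2/= /J -natr1 lerD2r.
Qed.
Let lE : l%:R = (J%:R + 1) * A - 1.
Proof.
have h : (J.+1 * K.*2.+2)%N = l.+1 by rewrite mulSn addnC /l -addnS.
by rewrite natr1 /A -natrM h -natr1 addrK.
Qed.
(** The lower bound gives [2 * rho < r]; the upper bound gives the admissible length [theta1 * L]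
    with [theta1 = 3A], and cells of side comparable to [r]. *)
Let l_bounds : 2 * L < l%:R <= 3 * A * L.
Proof.
have /andP[J1 J2] := J_bounds.
have J3 : 4 * (L + 1) <= (J%:R + 1) * A.
  rewrite mulrC; apply: ler_pM => //; first by have := L_ge1; lra.
  by rewrite lerD2r ltW.
have J4 : (J%:R + 1) * A <= 3 * L * A.
  by rewrite ler_wpM2r ?(ltW A_gt0)//; have := L_ge1; lra.
by rewrite lE; have L1 := L_ge1; apply/andP; split; lra.
Qed.
Let l_gt0 : 0 < l%:R :> R. Proof. by have /andP[] := l_bounds; have := L_ge1; lra. Qed.
Let rho_gt0 : 0 < rho. Proof. exact: divr_gt0. Qed.
Let rho_r : 2 * rho < r.
Proof.
have /andP[l1 _] := l_bounds.
by rewrite /rho mulrA ltr_pdivrMr// zetaE mulrA mulrC ltr_pM2l.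
Qed.
Let rho_ge : r / (3 * A) <= rho.
Proof.
have /andP[_ l2] := l_bounds.
rewrite /rho ler_pdivlMr// mulrAC ler_pdivrMr ?mulr_gt0// zetaE [leRHS]mulrAC.
by rewrite [leRHS]mulrC ler_wpM2l ?(ltW r_gt0)// mulrC.
Qed.
Let q_rho : q <= rho / 2.
Proof.
apply: le_trans q_le _; rewrite ler_pdivlMr//; apply: le_trans rho_ge.
rewrite le_eqVlt; apply/orP; left; apply/eqP; field.
by rewrite gt_eqF.
Qed.

Let X_mass i k : (0 < k < l)%N ->
  c0 * r ^+ 2 <= pr P [set t | incell rho k (X i t)].
Proof.
move=> /andP[_ kl].
have kz : k.+1%:R * rho <= zeta.
  rewrite /rho mulrA ler_pdivrMr// mulrC ler_wpM2l ?(ltW zeta_gt0)//.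
  by rewrite ler_nat.
have rz : rho <= zeta.
  apply: le_trans kz; rewrite ler_peMl ?(ltW rho_gt0)//.
  by rewrite ler1n.
have cS : cell rho k `<=` unit_square.
  by apply: cell_unit_square => //; apply: le_trans (ltW zeta_lt).
have mc := measurable_cell rho k.
have := cell_mass rho_gt0 eps1_gt0 f_meas f_ge cS.
rewrite -(X_law i mc) /distribution/= /pushforward/= -incell_preimage.
rewrite (prE P (measurable_incell _ _ _ _)) lee_fin; apply: le_trans.
have -> : c0 * r ^+ 2 = eps1 * (r / (3 * A) / 2) ^+ 2.
  by rewrite /c0; field; rewrite gt_eqF.
have b0 : 0 <= r / (3 * A) / 2 by rewrite !divr_ge0 ?mulr_ge0 ?ltW.
have b1 : r / (3 * A) / 2 <= rho / 2 by rewrite ler_wpM2r ?rho_ge// invr_ge0.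
by rewrite ler_wpM2l ?(ltW eps1_gt0)// lerXn2r// nnegrE (le_trans b0).
Qed.

Let M := occupancy N c0.
Let E := expR (- (G * ln n%:R)).

Let M_ge : c0 / 8 <= M%:R / N.
Proof.
rewrite ler_pdivlMr//; have := @occupancy_ge R N c0 h4; rewrite -/M; lra.
Qed.

Let M2_ge : c0 ^+ 2 / 64 <= (M * M)%:R / N ^+ 2.
Proof.
have -> : (M * M)%:R / N ^+ 2 = (M%:R / N) ^+ 2 :> R by rewrite natrM expr_div_n expr2.
have -> : c0 ^+ 2 / 64 = (c0 / 8) ^+ 2 by field.
have b0 : 0 <= c0 / 8 by rewrite divr_ge0// ltW.
by rewrite lerXn2r// nnegrE (le_trans b0).
Qed.

Let locations_rate : 2 ^+ M * expR (- (n%:R * (c0 * r ^+ 2) / 2)) <= E.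
Proof.
have -> : n%:R * (c0 * r ^+ 2) / 2 = c0 * N / 2 by rewrite mulrCA.
apply: (@le_trans _ _ (expR M%:R * expR (- (c0 * N / 2)))).
  rewrite ler_wpM2r ?expR_ge0// -[M%:R]mulr1 expRM_natl lerXn2r ?nnegrE ?expR_ge0//.
  by apply: le_trans (expR_ge1Dx 1).
rewrite -expRD ler_expR.
have cN : 0 <= c0 * N / 4 by rewrite divr_ge0// mulr_ge0// ltW.
have /andP[Mle _] := truncn_itv cN.
have := hN; rewrite -/M/= in Mle *; lra.
Qed.

Let E_sum : l%:R * E + ((l * K.*2.+1)%:R * E + l%:R * E) <= (n%:R `^ (1 + gamma))^-1.
Proof.
have n0 : 0 < n%:R :> R by rewrite ltr0n (ltn_trans _ n_gt2).
have E0 : 0 <= E := expR_ge0 _.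
have -> : l%:R * E + ((l * K.*2.+1)%:R * E + l%:R * E) = l%:R * K.*2.+3%:R * E.
  by rewrite -[K.*2.+3]addn2 natrD natrM -natr1; ring.
apply: (@le_trans _ _ (n%:R * n%:R * E)).
  rewrite ler_wpM2r//; have /andP[_ l2] := l_bounds.
  apply: (@le_trans _ _ (3 * A * L * K.*2.+3%:R)); first by rewrite ler_wpM2r.
  rewrite mulrAC; apply: ler_pM => //; first by rewrite !mulr_ge0// ltW.
  by have := L_ge1; lra.
rewrite /E -{1 2}[n%:R]lnK// -!expRD /powR gt_eqF// -expRN ler_expR.
by rewrite /G; lra.
Qed.

Let J_l : J%:R <= l%:R :> R.
Proof. by rewrite ler_nat /l (leq_trans _ (leq_addr _ _))// leq_pmulr. Qed.

(** A stage has at least [M^2] edges, so it fails with probability at most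
    [expR (- (c0^2 / 64 * logk))]; the exponent [1 + kappa > 1] puts this below [n^(-G)], and a
    union bound over the stages suffices. *)
Lemma few_heavy_all (p' : R) : logk / N ^+ 2 <= p' ->
  forall Y : 'I_J -> T -> bool,
  (forall j, measurable [set t | Y j t]) ->
  (forall S : {set 'I_J}, pr P [set t | [forall j in S, ~~ Y j t]] <=
     expR (- (p' * (M * M)%:R)) ^+ #|S|) ->
  pr P [set t | (#|[set j | Y j t]%SET| < J)%N] <= l%:R * E.
Proof.
move=> p'le Y mY /(some_bad_bound mY) bad; apply: le_trans bad _.
rewrite ler_pM ?expR_ge0// ler_expR lerN2; apply: le_trans hk1 _.
apply: (@le_trans _ _ (logk / N ^+ 2 * (M * M)%:R)); last by rewrite ler_wpM2r.
rewrite [leLHS]mulrC -mulrA [in leRHS](mulrC _ (M * M)%:R).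
by rewrite ler_wpM2l// ltW.
Qed.

(** Each stage now fails with probability at most a constant below 1. The error [expR (- (c2 * J))]
    of the fraction bound is below [n^(-G)] because [J > L > logk]. *)
Lemma few_heavy_most : logk < L ->
  forall Y : 'I_J -> T -> bool,
  (forall j, measurable [set t | Y j t]) ->
  (forall S : {set 'I_J}, pr P [set t | [forall j in S, ~~ Y j t]] <=
     expR (- ((N ^+ 2)^-1 * (M * M)%:R)) ^+ #|S|) ->
  pr P [set t | (#|[set j | Y j t]%SET| < J %/ B.*2)%N] <= l%:R * E.
Proof.
move=> kL Y mY YS.
have l1 : 1 <= l%:R :> R by apply: le_trans J_l; rewrite ler1n.
apply: (@le_trans _ _ E); last by rewrite ler_peMl// expR_ge0.
apply: (@le_trans _ _ (expR (- (c2 * J%:R)))); last first.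
  rewrite ler_expR lerN2; apply: le_trans hk2 _; rewrite ler_wpM2l ?(ltW c2_gt0)//.
  by have /andP[LJ _] := J_bounds; rewrite ltW// (lt_trans kL).
apply: le_trans (rate J).
have hJ : (J %/ B.*2 <= #|'I_J|)%N by rewrite card_ord leq_div.
have := few_good_bound mY (expR_ge0 (- (c0 ^+ 2 / 64))) y_ge1 hJ.
rewrite card_ord; apply => S; apply: le_trans (YS S) _.
by rewrite lerXn2r ?nnegrE ?expR_ge0// ler_expR lerN2 [leRHS]mulrC.
Qed.

Let H_gt0 z : z0 < z -> 0 < H z.
Proof. by move=> z0z; apply: le_lt_trans (inv_ccdf_ge0 nu z0) (H_incr _ z0z). Qed.

Let Ne_lt : N `^ (1 - eps) < N.
Proof.
rewrite /powR gt_eqF// -[ltRHS]lnK ?posrE// ltr_expR gtr_pMl ?ln_gt0//.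
by have := eps_gt0; lra.
Qed.

Lemma fixed_size_estimate :
  ((1 - (n%:R `^ (1 + gamma))^-1)%:E <=
   P [set t | (B.*2.*2%:R^-1 * L * alpha_scale H kappa n N L <=
     max_weight r (location zeta (fun i => X i t)) (fun e => W e t)
       (3 * A * L) q (H (N `^ (1 - eps))))%R])%E.
Proof.
have B4 : 0 < B.*2.*2%:R :> R by rewrite ltr0n !double_gt0.
have sM := @growth_fits R K N eps c0 (ltW N_gt1) eps_gt0 eps_lt K_ge c0_gt0 h3 h4.
have G0 : 0 <= G by rewrite /G; have := gamma_gt0; lra.
have expand := @growth_expand_rate R n K N eps c0 G n_gt2 (ltW N_gt1) eps_gt0 eps_lt
  K_ge c0_gt0 G0 h1 h3 h4.
have join := @growth_join_rate R n K N eps G n_gt2 (ltW N_gt1) eps_gt0 eps_lt K_ge G0 h2.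
have Hw := H_gt0 hz.
have w_tail := inv_ccdf_tail Hw.
have p0 : 0 <= (N `^ (1 - eps))^-1 by rewrite invr_ge0 powR_ge0.
have /andP[_ ltheta] := l_bounds.
have zE : zeta = l%:R * rho by rewrite /rho mulrC divfK// gt_eqF.
have lE0 : 0 <= l%:R * E by rewrite mulr_ge0// expR_ge0.
(* Both cases of [alpha_scale] at once: [z] is the argument of [H] in [alpha], and [h] the
   guaranteed number of heavy stages. *)
have main (h : nat) (z : R) : N `^ (1 - eps) < z ->
    B.*2.*2%:R^-1 * L <= h%:R ->
    (forall Y : 'I_J -> T -> bool,
      (forall j, measurable [set t | Y j t]) ->
      (forall S : {set 'I_J}, pr P [set t | [forall j in S, ~~ Y j t]] <=
         expR (- (z^-1 * (M * M)%:R)) ^+ #|S|) ->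
      pr P [set t | (#|[set j | Y j t]%SET| < h)%N] <= l%:R * E) ->
    ((1 - (n%:R `^ (1 + gamma))^-1)%:E <=
     P [set t | (B.*2.*2%:R^-1 * L * H z <=
       max_weight r (location zeta (fun i => X i t)) (fun e => W e t)
         (3 * A * L) q (H (N `^ (1 - eps))))%R])%E.
  move=> Nz hL few.
  have Hz := H_gt0 (lt_trans hz Nz).
  have z_ge0 : 0 <= z^-1 by rewrite invr_ge0 (le_trans (powR_ge0 _ _) (ltW Nz)).
  apply: le_trans (@max_weight_bound _ T R P n X W nu X_indep W_law W_indep XW_indep
    K J M h (fun i => growth K N eps ^ i)%N rho r zeta q (H (N `^ (1 - eps))) (H z)
    K_gt0 (expn0 _) sM rho_gt0 rho_r q_rho zE (ltW Hw)
    (ltW (H_incr (ltW hz) Nz)) (c0 * r ^+ 2) (N `^ (1 - eps))^-1 z^-1 (G * ln n%:R)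
    (l%:R * E) lE0 X_mass p0 z_ge0 w_tail (inv_ccdf_tail Hz) expand join few
    (3 * A * L) (B.*2.*2%:R^-1 * L * H z) ltheta _ _).
  - rewrite lee_fin lerD2l lerN2; apply: le_trans E_sum; rewrite lerD2r.
    by rewrite ler_wpM2l.
  - by rewrite !mulr_gt0 ?invr_gt0//; have := L_ge1; lra.
  - by rewrite ler_wpM2r// ltW.
have B1 : B.*2.*2%:R^-1 <= 1 :> R by rewrite invf_le1// ler1n !double_gt0.
have L0 : 0 <= L := le_trans ler01 L_ge1.
have /andP[LJ _] := J_bounds.
rewrite /alpha_scale -/logk; case: ifPn => [Lk|]; last rewrite -ltNge => kL.
  apply: (main J).
  (* From [logk <= N] the argument [N^2 / logk] is at least [N], hence above [N^(1-eps)], so that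
     [alpha] exceeds [w]. *)
  - rewrite ltr_pdivlMr// expr2; apply: (@le_lt_trans _ _ (N `^ (1 - eps) * N)).
      by rewrite ler_wpM2l// powR_ge0.
    by rewrite ltr_pM2r.
  - by apply: le_trans (ltW LJ); rewrite ler_piMl.
  - by apply: few_heavy_all; rewrite invf_div.
apply: (main (J %/ B.*2)%N).
- apply: (lt_trans Ne_lt); rewrite expr2 ltr_pMr//.
- rewrite mulrC ler_pdivrMr//; apply: (le_trans (ltW LJ)).
  rewrite -natrM ler_nat leq_div_double// -(ler_nat R) (le_trans hk3)//.
  by rewrite (le_trans (ltW kL))// ltW.
- exact: few_heavy_most.
Qed.

End LargeSize.

(** * Asymptotics: the numerical inequalities hold for all large [n] *)

Theorem theorem1 (R : realType)
  (d : nat -> measure_display) (T : forall n, measurableType (d n))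
  (P : forall n, probability (T n) R)
  (f : R * R -> R) (eps1 eps2 : R)
  (nu : probability R R)
  (X : forall n, 'I_n -> {RV (P n) >-> (R * R)%type})
  (W : forall n, {set vertex n} -> {RV (P n) >-> R})
  (r zeta : nat -> R) (beta c : R)
  (eps1_gt0 : 0 < eps1) (eps2_gt0 : 0 < eps2)
  (f_meas : measurable_fun unit_square f)
  (f_bounds : forall x, unit_square x -> eps1 <= f x <= eps2)
  (f_density :
    (\int[lebesgue_measure \x lebesgue_measure]_(x in unit_square) (f x)%:E
       = 1)%E)
  (X_law : forall n (i : 'I_n) (A : set (R * R)), measurable A ->
    (distribution (P n) (X n i) A
       = \int[lebesgue_measure \x lebesgue_measure]_(x in A `&` unit_square)
           (f x)%:E)%E)
  (X_indep : forall n, mutually_independent (P n) [set: 'I_n]%SET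
    (fun i => g_sigma_algebra_preimage (X n i)))
  (W_law : forall n e, e \in K2_edges n -> forall A : set R, measurable A ->
    distribution (P n) (W n e) A = nu A)
  (W_pos : forall n e, e \in K2_edges n ->
    {ae P n, forall t, 0 < W n e t})
  (W_indep : forall n, mutually_independent (P n) (K2_edges n)
    (fun e => g_sigma_algebra_preimage (W n e)))
  (XW_indep : forall n, independent_classes (P n)
    (sigma_of_family [set: 'I_n]%SET (fun i => X n i : T n -> R * R))
    (sigma_of_family (K2_edges n) (fun e => W n e : T n -> R)))
  (r_range : forall n, 0 < r n < 1)
  (zeta_range : forall n, 0 < zeta n < 2^-1)
  (beta_gt0 : 0 < beta) (beta_lt_c : beta < c) (c_lt_half : c < 2^-1)
  (r_lower : \forall n \near \oo, (n%:R `^ beta)^-1 <= r n)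
  (L_lower : \forall n \near \oo, 1 <= zeta n / r n)
  (H_incr : exists z0 : R, forall z1 z2 : R, z0 <= z1 -> z1 < z2 ->
    inv_ccdf nu z1 < inv_ccdf nu z2) :
  forall gamma kappa : R, 0 < gamma -> 0 < kappa ->
  exists2 epsilon0 : R, 0 < epsilon0 < 1 &
  forall epsilon : R, 0 < epsilon < epsilon0 ->
  exists theta1 theta2 : R, [/\ 0 < theta1, 0 < theta2 &
    \forall n \near \oo,
      let L := zeta n / r n in
      let N := n%:R * r n ^+ 2 in
      let q := (n%:R `^ c)^-1 in
      let w := inv_ccdf nu (N `^ (1 - epsilon)) in
      let alpha := alpha_scale (inv_ccdf nu) kappa n N L in
      let M := fun t : T n =>
        max_weight (r n) (location (zeta n) (fun i => X n i t))
          (fun e => W n e t) (theta1 * L) q w in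
      ((1 - (n%:R `^ (1 + gamma))^-1)%:E
         <= P n [set t | (theta2 * L * alpha <= M t)%R])%E].
Proof.
move=> gamma kappa gamma_gt0 kappa_gt0.
exists 2^-1; first by apply/andP; split; lra.
move=> epsilon /andP[eps_gt0 eps_lt].
(* More than [2 / epsilon] steps, so that [N^(1/K)] is at most [N^(epsilon/2)]. *)
pose K := (Num.truncn (2 / epsilon)).+1.
pose A : R := K.*2.+2%:R.
pose c0 : R := eps1 / (36 * A ^+ 2).
have A_gt0 : 0 < A by [].
have c0_gt0 : 0 < c0 by rewrite divr_gt0// mulr_gt0// exprn_gt0.
have K_ge : 2 / epsilon <= K%:R.
  by apply: ltW; have /andP[] := truncn_itv (ltW (divr_gt0 (ltr0n R 2) eps_gt0)).
have x_lt1 : expR (- (c0 ^+ 2 / 64)) < 1.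
  by rewrite expR_lt1 oppr_lt0 divr_gt0// exprn_gt0.
have [B [y [c2 [B_gt0 y_ge1 c2_gt0 rate]]]] := few_good_rate (expR_ge0 _) x_lt1.
have [z0 H_mono] := H_incr.
exists (3 * A), (B.*2.*2%:R^-1); split.
- by rewrite mulr_gt0.
- by rewrite invr_gt0 ltr0n !double_gt0.
pose G : R := gamma + 3.
(* From [r >= n^(-beta)] one gets [N >= n^tau]; every positive power of [N] then dominates
   [log n]. *)
pose tau : R := 1 - 2 * beta.
have tau_gt0 : 0 < tau by rewrite /tau; lra.
have te_gt0 : 0 < tau * (epsilon / 2) by rewrite mulr_gt0// divr_gt0.
have te1_gt0 : 0 < tau * (1 - epsilon) by rewrite mulr_gt0//; lra.
have cb_gt0 : 0 < c - beta by lra.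
have k1_gt0 : 0 < 1 + kappa by lra.
have tk_gt0 : 0 < tau / (1 + kappa) by rewrite divr_gt0.
near=> n; pose N := n%:R * r n ^+ 2; pose q := (n%:R `^ c)^-1.
have n_gt2 : (2 < n)%N by near: n; exact: nbhs_infty_gt.
have n_ge1 : 1 <= n%:R :> R by rewrite ler1n (leq_trans _ n_gt2).
have n_gt0 : 0 < n%:R :> R by rewrite (lt_le_trans _ n_ge1).
have r_ge : (n%:R `^ beta)^-1 <= r n by near: n.
have L_ge1 : 1 <= zeta n / r n by near: n.
have /andP[r_gt0 _] := r_range n; have /andP[zeta_gt0 zeta_lt] := zeta_range n.
have powD x1 x2 : n%:R `^ (x1 + x2) = n%:R `^ x1 * n%:R `^ x2 :> R.
  by rewrite powRD//; apply/implyP => _; rewrite gt_eqF.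
have nb_gt0 : 0 < n%:R `^ beta by rewrite powR_gt0.
have r_nb : 1 <= r n * n%:R `^ beta by rewrite -ler_pdivrMr// mul1r.
have N_ge : n%:R `^ tau <= N.
  have -> : n%:R `^ tau = n%:R * ((n%:R `^ beta)^-1) ^+ 2 :> R.
    rewrite /tau powD powRr1 ?(ltW n_gt0)// exprVn -powR_mulrn ?powR_ge0//.
    by rewrite -powRrM -powRN (mulrC 2 beta).
  rewrite ler_wpM2l ?(ltW n_gt0)// lerXn2r ?nnegrE ?invr_ge0 ?(ltW nb_gt0)//.
  exact: ltW.
have N_pow x : 0 <= x -> n%:R `^ (tau * x) <= N `^ x.
  move=> x0; rewrite powRrM ge0_ler_powR ?nnegrE ?powR_ge0//.
  exact: le_trans (powR_ge0 _ _) N_ge.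
have N_gt1 : 1 < N.
  apply: lt_le_trans N_ge; apply: (@lt_le_trans _ _ 2); first by rewrite ltr1n.
  by near: n; exact: near_powR_ge.
have lnn_ge1 : 1 <= ln n%:R :> R by near: n; exact: near_ln_ge.
have lnn_gt0 : 0 < ln n%:R :> R by rewrite (lt_le_trans _ lnn_ge1).
have logkE : (ln n%:R) `^ (1 + kappa) = ln n%:R * (ln n%:R) `^ kappa :> R.
  rewrite powRD ?powRr1 ?(ltW lnn_gt0)//.
  by apply/implyP => _; rewrite gt_eqF.
have logk_ln C x : 0 < x -> C / x <= (ln n%:R) `^ kappa ->
    C * ln n%:R <= x * (ln n%:R) `^ (1 + kappa).
  move=> x0; rewrite ler_pdivrMr// => Cx.
  by rewrite logkE (mulrCA x) [leRHS]mulrC ler_wpM2r ?(ltW lnn_gt0)// [leRHS]mulrC.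
have e2_ge0 : 0 <= epsilon / 2 by rewrite divr_ge0// ltW.
apply: (@fixed_size_estimate _ (T n) R (P n) n (X n) (W n) nu f eps1 eps1_gt0 f_meas _
  (X_law n) (X_indep n) (W_law n) (W_indep n) (XW_indep n) K B (r n) (zeta n) q epsilon
  gamma kappa y c2 z0 r_gt0 zeta_gt0 zeta_lt L_ge1 _ _ eps_gt0 eps_lt gamma_gt0
  K_ge isT B_gt0 y_ge1 c2_gt0 rate H_mono n_gt2 N_gt1).
- by move=> x /f_bounds/andP[].
(* [L <= n] holds because [zeta <= 1 <= r * n^beta <= r * n]. *)
- rewrite ler_pdivrMr//; apply: (@le_trans _ _ 1); first by lra.
  apply: (le_trans r_nb); rewrite mulrC ler_wpM2r ?(ltW r_gt0)//.
  by rewrite -[leRHS]powRr1 ?(ltW n_gt0)// ler_powR//; lra.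
(* The strict inequality [beta < c] makes [q] smaller than any fixed multiple of [r]. *)
- have cA : 6 * A <= n%:R `^ (c - beta) by near: n; exact: near_powR_ge.
  rewrite /q -[c](subrK beta) powD invfM [leRHS]mulrC.
  apply: ler_pM; rewrite ?invr_ge0 ?powR_ge0//.
  by rewrite lef_pV2 ?posrE ?powR_gt0// mulr_gt0.
- apply: le_trans (N_pow _ e2_ge0); near: n; exact: near_ln_powR.
- apply: le_trans (N_pow _ e2_ge0); near: n; exact: near_ln_powR.
- apply: le_trans (N_pow _ e2_ge0); near: n; exact: near_powR_ge.
- rewrite mulrC -ler_pdivrMr//; apply: le_trans N_ge; near: n; exact: near_powR_ge.
- have hN : 4 * G / c0 * ln n%:R <= n%:R `^ tau by near: n; exact: near_ln_powR.
  have := le_trans hN N_ge; rewrite mulrAC ler_pdivrMr// -/A -/c0 -/G -/N; lra.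
- near: n; exact: nbhs_infty_ger.
- apply: logk_ln; first by rewrite divr_gt0// exprn_gt0.
  by near: n; exact: near_powR_ln_ge.
- by apply: logk_ln => //; near: n; exact: near_powR_ln_ge.
- by near: n; exact: near_powR_ln_ge.
- have lk : 1 * ln n%:R <= n%:R `^ (tau / (1 + kappa)) by near: n; exact: near_ln_powR.
  rewrite mul1r in lk; apply: le_trans N_ge.
  have -> : n%:R `^ tau = (n%:R `^ (tau / (1 + kappa))) `^ (1 + kappa) :> R.
    by rewrite -powRrM divfK// gt_eqF.
  by rewrite ge0_ler_powR ?nnegrE ?powR_ge0 ?(ltW lnn_gt0) ?(ltW k1_gt0).
- exact: powR_gt0.
- have h1e : 0 <= 1 - epsilon by lra.
  apply: lt_le_trans (N_pow _ h1e); apply: (@lt_le_trans _ _ (z0 + 1)); first by rewrite ltrDl.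
  by near: n; exact: near_powR_ge.
Unshelve. all: by end_near. Qed.
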